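(* Let $(\Omega,\mathcal B,\mu,T,\alpha)$ be a probability-preserving, topologically mixing Gibbs-Markov map. Let $\{A_n\}_{n\in\mathbb N}$ be a sequence of measurable subsets of $\Omega$ satisfying the following two conditions: (a) there is $m\in\mathbb N$ such that $A_n\in\sigma(\alpha_0^{m-1})$ for all $n\in\mathbb N$; (b) for every $i\in\mathbb N$, $\displaystyle\lim_{n\to\infty}\frac{\mu(A_n\cap T^{-i}A_n)}{\mu(A_n)}=0$. If $n\mu(A_n)$ converges to a constant $t>0$ as $n\to\infty$, then for every $k\in\mathbb N_0$ $$\lim_{n\to\infty}\mu\left(\left\{x\in\Omega:\ \sum_{i=0}^{n-1}\mathbf 1_{A_n}\circ T^i(x)=k\right\}\right)=\frac{t^k}{k!}e^{-t}.$$
   Context: $\mathbb N=\{1,2,\dots\}$, $\mathbb N_0=\mathbb N\cup\{0\}$. $\mathbf 1_A$ is the indicator function of $A$. Let $(\Omega,\mathcal B,\mu)$ be a probability space, $T:\Omega\to\Omega$ a non-singular transformation and $\alpha$ a countable partition of $\Omega$ mod $\mu$. Write $\alpha_0^{n-1}=\bigvee_{i=0}^{n-1}T^{-i}\alpha$, and $\sigma(\cdot)$ for the $\sigma$-algebra generated by a partition. The quintuple $(\Omega,\mathcal B,\mu,T,\alpha)$ is called a Gibbs-Markov map if: (1) $\alpha$ is a strong generator of $\mathcal B$ under $T$, i.e. $\sigma(\{T^{-n}\alpha:n\in\mathbb N_0\})=\mathcal B$ mod $\mu$; (2) (big image property) $\inf_{a\in\alpha}\mu(Ta)>0$; (3)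 for every $a\in\alpha$, $Ta\in\sigma(\alpha)$ mod $\mu$, and the restriction $T|_a$ is invertible and non-singular; (4) for every $n\in\mathbb N$ and $a\in\alpha_0^{n-1}$, let $v_a:T^na\to a$ be the non-singular inverse branch of $T^n$ and $v_a'$ its Radon-Nikodym derivative; there exist $r\in(0,1)$ and $M>0$ such that for all $n\in\mathbb N$, $a\in\alpha_0^{n-1}$ and a.e. $x,y\in T^na$, $\left|\frac{v_a'(x)}{v_a'(y)}-1\right|\le M\, r(x,y)$, where $r(x,y)=r^{\min\{n\in\mathbb N:\ T^{n-1}(x)\text{ and }T^{n-1}(y)\text{ belong to different elements of }\alpha\}}$ (and $r(x,y)=0$ if there is no such $n$). The map is probability-preserving if $\mu$ is a $T$-invariant probability measure. It is topologically mixing if for all $a,b\in\alpha$ there is $n_{a,b}\in\mathbb N$ such that $b\subset T^na$ for every $n\ge n_{a,b}$. *)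

(* Defs.v *)
From HB Require Import structures.
From mathcomp Require Import all_boot all_order all_algebra.
From mathcomp Require Import all_classical all_reals all_analysis.
Import Order.TTheory GRing.Theory Num.Theory.
Import numFieldNormedType.Exports.

Set Implicit Arguments.
Unset Strict Implicit.
Unset Printing Implicit Defensive.

Local Open Scope classical_set_scope.
Local Open Scope ring_scope.

(* A partition is the set of its elements. *)
Section PartitionsAndItineraries.
Context (Omega : Type) (T : Omega -> Omega) (alpha : set (set Omega)).

(* The elements of alpha_0^{n-1}, for n >= 1; empty and null intersections are
   kept, which changes neither the generated sigma-algebra nor the conditions
   below. *)
Definition joined (n : nat) : set (set Omega) :=
  [set B | exists2 a : nat -> set Omega,
     (forall i, (i < n)%N -> alpha (a i)) &
     B = \bigcap_(i in `I_n) (iter i T @^-1` a i)].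

Definition preimages : set (set Omega) :=
  [set B | exists (n : nat) (a : set Omega), alpha a /\ B = iter n T @^-1` a].

Definition separated (x y : Omega) (n : nat) : bool :=
  (0 < n)%N &&
  `[< exists a b : set Omega,
        [/\ alpha a, alpha b, a <> b, a (iter n.-1 T x) & b (iter n.-1 T y)] >].

Definition sep_dist (R : realType) (r : R) (x y : Omega) : R :=
  match pselect (exists n, separated x y n) with
  | left h => r ^+ ex_minn h
  | right _ => 0
  end.

Definition inverse_branch (n : nat) (a : set Omega) (v : Omega -> Omega) :=
  forall x, a x -> v (iter n T x) = x.

End PartitionsAndItineraries.

Section GibbsMarkov.
Context (d : measure_display) (Omega : measurableType d) (R : realType).
Context (mu : probability Omega R) (T : Omega -> Omega).
Context (alpha : set (set Omega)).

Definition eq_mod (A B : set Omega) : Prop := mu.-negligible (A `+` B).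

Definition nonsingular : Prop :=
  measurable_fun setT T /\
  forall E, measurable E -> (mu (T @^-1` E) = 0%E <-> mu E = 0%E).

Definition measure_preserving : Prop :=
  measurable_fun setT T /\
  forall E, measurable E -> mu (T @^-1` E) = mu E.

Definition countable_partition_mod : Prop :=
  [/\ countable alpha,
      forall a, alpha a -> measurable a,
      forall a b, alpha a -> alpha b -> a <> b -> mu.-negligible (a `&` b) &
      mu.-negligible (~` \bigcup_(a in alpha) a)].

Definition strong_generator : Prop :=
  forall E, measurable E -> exists2 F, <<s preimages T alpha >> F & eq_mod E F.

Definition big_image : Prop :=
  (0%E < ereal_inf [set mu (T @` a) | a in alpha])%E.

(* The restriction T : a -> T a has a measurable inverse, and null sets
   correspond to null sets under it. *)
Definition invertible_nonsingular_on (a : set Omega) : Prop :=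
  [/\ {in a &, injective T},
      forall E, measurable E -> E `<=` a -> measurable (T @` E) &
      forall E, measurable E -> E `<=` a ->
        (mu (T @` E) = 0%E <-> mu E = 0%E)].

(* f is a version, on D, of the Radon-Nikodym derivative d(mu o v)/d mu. *)
Definition RN_derivative_on (D : set Omega) (v : Omega -> Omega)
    (f : Omega -> R) : Prop :=
  [/\ measurable_fun D f,
      forall x, D x -> 0 <= f x &
      forall E, measurable E -> E `<=` D ->
        mu (v @` E) = (\int[mu]_(x in E) (f x)%:E)%E].

Definition bounded_distortion : Prop :=
  exists (r M : R), [/\ 0 < r, r < 1, 0 < M &
    forall (n : nat) (a : set Omega), (0 < n)%N -> joined T alpha n a ->
      exists (v : Omega -> Omega) (v' : Omega -> R),
        [/\ inverse_branch T n a v,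
            RN_derivative_on (iter n T @` a) v v' &
            {ae mu, forall x, (iter n T @` a) x ->
            {ae mu, forall y, (iter n T @` a) y ->
              `|v' x / v' y - 1| <= M * sep_dist T alpha r x y}}]].

Record gibbs_markov : Prop := GibbsMarkov {
  gm_nonsingular : nonsingular;
  gm_partition : countable_partition_mod;
  gm_generator : strong_generator;
  gm_big_image : big_image;
  gm_markov : forall a, alpha a ->
    (exists2 B, <<s alpha >> B & eq_mod (T @` a) B) /\
    invertible_nonsingular_on a;
  gm_distortion : bounded_distortion }.

(* b is included in T^n a mod mu.  As alpha covers the space only mod mu, the
   set-theoretic image of a is not determined mod mu: T a may meet the null set
   not covered by alpha, on which T is unconstrained and which T may even map
   onto the whole space.  Hence the image must cover almost all of b whatever
   null set is removed from a; if T maps null sets to null sets, this just says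
   that b `\` (iter n T @` a) is null. *)
Definition sub_image_mod (n : nat) (a b : set Omega) : Prop :=
  forall N, mu.-negligible N ->
    mu.-negligible (b `\` (iter n T @` (a `\` N))).

Definition topologically_mixing : Prop :=
  forall a b, alpha a -> alpha b ->
    exists2 n_ab : nat, (0 < n_ab)%N &
      forall n, (n_ab <= n)%N -> sub_image_mod n a b.

End GibbsMarkov.

(* Main.v *)
(** Write N_L for the number of visits to A = A_n during the times 0, ..., L-1,
    and p_k(L) for the probability that N_L = k. As N_{L+1} = 1_A + N_L o T and
    mu is invariant,
<<
      p_k(L+1) = p_k(L) - mu(A, N_L o T = k) + mu(A, N_L o T = k-1).
>>
    If mu(A, N_L o T = k) were mu(A) p_k(L), this would be the recursion of the
    binomial distribution with parameters L and mu(A). The error is controlled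
    in two steps. Condition (b) allows one to ignore the visits at times
    1, ..., s-1, for any fixed s. Conditionally on A, the orbit after time
    s = m + p is then within dl of equidistribution, uniformly over A in
    sigma(alpha_0^{m-1}), where dl is arbitrarily small for p large. As the
    recursion is a convex combination, its errors simply add up, and the
    Poisson limit of the binomial distribution concludes.

    The uniform equidistribution is a Doeblin argument. Bounded distortion, the
    big image property and topological mixing provide a common minorant of the
    laws of T^{n+n0} conditioned on the cylinders of all lengths n. Given the
    next q symbols, the dependence on the past is at most a factor 1 + M r^q;
    hence the spread of these laws contracts up to an error O(r^q). *)

Require Import Defs.
From HB Require Import structures.
From mathcomp Require Import all_boot all_order all_algebra.
From mathcomp Require Import all_classical all_reals all_analysis.
From mathcomp Require Import measurable_realfun ring lra.
Import Order.TTheory GRing.Theory Num.Theory.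
Import numFieldNormedType.Exports.
Local Open Scope classical_set_scope.
Local Open Scope ring_scope.

Set Implicit Arguments.
Unset Strict Implicit.
Unset Printing Implicit Defensive.

(** * Real-valued probabilities, partitions mod null sets, preserved measures *)

Section Probability.
Context (R : realType) (d : measure_display) (Omega : measurableType d).
Context (mu : probability Omega R).
Implicit Types (A B E U X : set Omega) (C : set (set Omega)).

Definition prob E : R := fine (mu E).
Local Notation P := prob.

Lemma probE E : measurable E -> mu E = (P E)%:E.
Proof. by move=> mE; rewrite /P fineK// fin_num_measure. Qed.

Lemma prob_ge0 E : 0 <= P E.
Proof. exact: fine_ge0. Qed.

Lemma le_prob A B : measurable A -> measurable B -> A `<=` B -> P A <= P B.
Proof.
by move=> mA mB AB; rewrite -lee_fin -!probE// le_measure// inE.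
Qed.

Lemma probT : P setT = 1.
Proof. by rewrite /P probability_setT. Qed.

Lemma prob_set0 : P set0 = 0.
Proof. by rewrite /P measure0. Qed.

Lemma prob_le1 E : measurable E -> P E <= 1.
Proof. by move=> mE; rewrite -probT le_prob. Qed.

Lemma probU A B : measurable A -> measurable B -> A `&` B = set0 ->
  P (A `|` B) = P A + P B.
Proof.
move=> mA mB AB0; apply: EFin_inj; rewrite EFinD -!probE//; last exact: measurableU.
  by rewrite measureU.
Qed.

Lemma prob_splitI A B : measurable A -> measurable B ->
  P A = P (A `&` B) + P (A `\` B).
Proof.
move=> mA mB; rewrite -probU ?setUIDK//.
- exact: measurableI.
- exact: measurableD.
- by rewrite setDE setIACA setICr setI0.
Qed.


Lemma prob_null E : measurable E -> mu.-negligible E -> P E = 0.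
Proof. by move=> mE /measure_negligible nE; rewrite /P nE. Qed.

Lemma null_prob E : measurable E -> P E = 0 -> mu.-negligible E.
Proof. by move=> mE E0; apply/negligibleP => //; have := probE mE; rewrite E0. Qed.

Lemma prob_subnull A B : measurable A -> measurable B -> A `<=` B ->
  P B = 0 -> P A = 0.
Proof.
by move=> mA mB AB B0; apply/eqP; rewrite eq_le prob_ge0 andbT -B0 le_prob.
Qed.

Lemma prob_setI_full A B : measurable A -> measurable B -> P (A `\` B) = 0 ->
  P (A `&` B) = P A.
Proof. by move=> mA mB AB0; rewrite [RHS](prob_splitI (B := B))// AB0 addr0. Qed.

Lemma le_prob_mod A B : measurable A -> measurable B -> P (A `\` B) = 0 ->
  P A <= P B.
Proof.
move=> mA mB AB0; rewrite -(prob_setI_full mA mB AB0) le_prob//.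
exact: measurableI.
Qed.

(** In effect a finite signed measure absolutely continuous with respect to [mu], reduced to what
    [partition_le0] uses. The sign is free, so that comparing two measures amounts to bounding their
    difference by 0. *)
Definition null_additive (s : set Omega -> R) :=
  [/\ forall A B, measurable A -> measurable B -> A `&` B = set0 ->
        s (A `|` B) = s A + s B,
      forall A, measurable A -> P A = 0 -> s A = 0 &
      forall F : nat -> set Omega, (forall n, measurable (F n)) ->
        nondecreasing_seq F -> s (F n) @[n --> \oo] --> s (\bigcup_n F n)].

Lemma null_additive_prob X : measurable X -> null_additive (fun E => P (X `&` E)).
Proof.
move=> mX; split.
- move=> A B mA mB AB0; rewrite setIUr probU//; [exact: measurableI..|].
  by rewrite setIACA AB0 setI0.
- move=> A mA A0; apply: prob_subnull A0 => //; first exact: measurableI.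
- move=> F mF ndF; rewrite setI_bigcupr.
  have mXF i : measurable (X `&` F i) by exact: measurableI.
  apply: (@fine_cvg _ _ _ _ (fun n => mu (X `&` F n))).
  rewrite -probE; last exact: bigcup_measurable.
  apply: nondecreasing_cvg_mu => //; first exact: bigcup_measurable.
  move=> m n mn; have /subsetPset FF := ndF _ _ mn.
  by apply/subsetPset; exact: setIS.
Qed.

Lemma null_additiveD s s' : null_additive s -> null_additive s' ->
  null_additive (fun E => s E + s' E).
Proof.
move=> [sU s0 sc] [s'U s'0 s'c]; split.
- by move=> A B mA mB AB0; rewrite sU// s'U// addrACA.
- by move=> A mA A0; rewrite s0// s'0// addr0.
- by move=> F mF ndF; apply: cvgD; [exact: sc|exact: s'c].
Qed.

Lemma null_additiveZ c s : null_additive s -> null_additive (fun E => c * s E).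
Proof.
move=> [sU s0 sc]; split.
- by move=> A B mA mB AB0; rewrite sU// mulrDr.
- by move=> A mA A0; rewrite s0// mulr0.
- by move=> F mF ndF; apply: cvgMr; exact: sc.
Qed.

Lemma partition_enum C : countable_partition_mod mu C ->
  exists g : nat -> set Omega,
    [/\ forall n, C (g n) \/ g n = set0,
        forall m n, m <> n -> P (g m `&` g n) = 0,
        forall b, C b -> exists n, b = g n &
        P (~` \bigcup_n g n) = 0].
Proof.
move=> [/countable_injP[f finj] mC dC covC].
pose g n := xget set0 [set b | C b /\ f b = n].
have gP n : C (g n) /\ f (g n) = n \/ g n = set0.
  rewrite /g; case: xgetP => [b _ [Cb fb]|_]; [by left|by right].
have gC b : C b -> g (f b) = b.
  move=> Cb; rewrite /g; case: xgetP => [b' _ [Cb' fb']|/(_ b)[]//].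
  by apply: finj => //; rewrite inE.
have mg n : measurable (g n) by case: (gP n) => [[/mC]|->].
exists g; split.
- by move=> n; case: (gP n) => [[]|]; [left|right].
- move=> m n mn; apply: prob_null; first exact: measurableI.
  case: (gP m) => [[Cm fm]|->]; last by rewrite set0I; exact: negligible_set0.
  case: (gP n) => [[Cn fn]|->]; last by rewrite setI0; exact: negligible_set0.
  by apply: dC => // gmn; apply: mn; rewrite -fm -fn gmn.
- by move=> b Cb; exists (f b); rewrite gC.
- apply: prob_null; first by apply: measurableC; exact: bigcup_measurable.
  apply: negligibleS covC => x; apply: contra_not => -[b Cb bx].
  by exists (f b) => //; rewrite gC.
Qed.

Lemma prob_bigsetU_null (g : nat -> set Omega) n E :
  measurable E -> (forall i, measurable (g i)) ->
  (forall i, (i < n)%N -> P (E `&` g i) = 0) ->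
  P (E `&` \big[setU/set0]_(i < n) g i) = 0.
Proof.
move=> mE mg E0; apply: prob_null.
  by apply: measurableI => //; exact: bigsetU_measurable.
rewrite big_distrr/= -(big_mkord xpredT (fun i => E `&` g i)) big_nat.
apply: negligible_bigsetU => i /andP[_ ni].
by apply: null_prob; [exact: measurableI|exact: E0].
Qed.

Lemma bigcup_partial_unions (g : nat -> set Omega) :
  \bigcup_n \big[setU/set0]_(i < n) g i = \bigcup_n g n.
Proof.
rewrite -[RHS]bigcup_bigsetU_bigcup; apply/seteqP; split=> x [n _ gx].
  case: n gx => [|n] gx; last by exists n.
  by move: gx; rewrite big_ord0.
by exists n.+1.
Qed.

(** Cells overlap in null sets only, so finite unions inherit the bound by additivity; continuity
    from below and the null complement carry it to the whole space. Every summation over cylinders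
    below goes through this lemma. *)
Lemma partition_le0 C s : countable_partition_mod mu C -> null_additive s ->
  (forall b, C b -> s b <= 0) -> s setT <= 0.
Proof.
move=> Cp; have [_ mC _ _] := Cp; move=> [sU s0 sc] sC.
have [g [gC dg _ gcov]] := partition_enum Cp.
have mg n : measurable (g n) by case: (gC n) => [/mC|->].
pose U n := \big[setU/set0]_(i < n) g i.
have mU n : measurable (U n) by exact: bigsetU_measurable.
have sU0 n : s (U n) <= 0.
  elim: n => [|n ih]; first by rewrite /U big_ord0 s0// prob_set0.
  rewrite /U big_ord_recr/= -/(U n).
  have -> : U n `|` g n = U n `|` (g n `\` U n).
    by apply/seteqP; split=> x; rewrite /setU /setD /=;
      case: (pselect (U n x)); tauto.
  rewrite sU//; first last.
  - by rewrite setDE setICA setICr setI0.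
  - exact: measurableD.
  have gU : s (g n `&` U n) = 0.
    apply: s0; first exact: measurableI.
    apply: prob_bigsetU_null => // i ni; apply: dg => ni'.
    by rewrite ni' ltnn in ni.
  have : s (g n) <= 0.
    by case: (gC n) => [/sC//|->]; rewrite s0// prob_set0.
  rewrite -[X in s X <= 0](setUIDK _ (U n)) sU ?gU ?add0r//.
  - by move=> ?; lra.
  - exact: measurableI.
  - exact: measurableD.
  - by rewrite setDE setIACA setICr setI0.
have mgU : measurable (\bigcup_n g n) by exact: bigcup_measurable.
have -> : s setT = s (\bigcup_n U n).
  rewrite [RHS](congr1 s (bigcup_partial_unions g)).
  rewrite -(setUv (\bigcup_n g n)) sU ?setICr//; last exact: measurableC.
  by rewrite (s0 (~` _)) ?addr0//; exact: measurableC.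
have ndU : nondecreasing_seq U 
  by move=> m n mn; exact/subsetPset/subset_bigsetU.
have := sc _ mU ndU; move/cvg_lim => <-//.
apply: limr_le; last by apply: nearW => n; exact: sU0.
by apply/cvg_ex; eexists; exact: sc.
Qed.

(** The unions of cells mod [mu], described by how they meet each cell; this form is stable under
    modification on null sets. *)
Definition dichotomic C B := measurable B /\
  forall b, C b -> P (b `&` B) = 0 \/ P (b `\` B) = 0.

(** Dichotomic sets form a sigma-algebra that contains the cells. For a countable union, either some
    member covers the cell mod [mu], or all members meet it in null sets. *)
Lemma generated_dichotomic C B : countable_partition_mod mu C ->
  <<s C >> B -> dichotomic C B.
Proof.
move=> [cC mC dC covC]; apply: smallest_sub; last first.
  move=> a Ca; split; first exact: mC.
  move=> b Cb; case: (pselect (b = a)) => [->|ba].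
    by right; rewrite setDv prob_set0.
  by left; apply: prob_null; [apply: measurableI; exact: mC|exact: dC].
split.
- by split => // b Cb; left; rewrite setI0 prob_set0.
- move=> A [mA hA]; split; first exact: measurableD.
  move=> b Cb; have [h|h] := hA b Cb.
    by right; rewrite setTD setDE setCK.
  by left; rewrite setTD -setDE.
- move=> F hF; split; first by apply: bigcup_measurable => n _; case: (hF n).
  have mF n : measurable (F n) by case: (hF n).
  move=> b Cb; have mb := mC _ Cb.
  case: (pselect (exists n, P (b `\` F n) = 0)) => [[n bF0]|].
    right; apply: prob_subnull bF0.
    - by apply: measurableD => //; exact: bigcup_measurable.
    - exact: measurableD.
    - by apply: setDS; exact: bigcup_sup.
  move=> /forallNP bF; left.
  have mbF n : measurable (b `&` F n) by exact: measurableI.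
  rewrite setI_bigcupr; apply: prob_null; first exact: bigcup_measurable.
  apply: negligible_bigcup => n; apply: null_prob => //.
  by have [_ /(_ b Cb)[//|/bF]] := hF n.
Qed.

Definition joinp C C' : set (set Omega) :=
  [set a `&` b | a in C & b in C'].

Lemma partition_join C C' : countable_partition_mod mu C ->
  countable_partition_mod mu C' -> countable_partition_mod mu (joinp C C').
Proof.
move=> [cC mC dC covC] [cC' mC' dC' covC']; split.
- have -> : joinp C C' = (fun u => u.1 `&` u.2) @` (C `*` C').
    apply/seteqP; split => [_ [a Ca [b Cb <-]]|_ [[a b] [/= Ca Cb] <-]].
      by exists (a, b).
    by exists a => //; exists b.
  apply: card_le_trans (card_image_le _ _) _; exact: countableX.
- by move=> _ [a Ca [b Cb <-]]; apply: measurableI; [exact: mC|exact: mC'].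
- move=> _ _ [a Ca [b Cb <-]] [a' Ca' [b' Cb' <-]] neq.
  case: (pselect (a = a')) => [aa'|aa'].
    have bb' : b <> b' by move=> bb'; apply: neq; rewrite aa' bb'.
    by apply: negligibleS (dC' _ _ Cb Cb' bb'); rewrite setIACA; exact: subIsetr.
  by apply: negligibleS (dC _ _ Ca Ca' aa'); rewrite setIACA; exact: subIsetl.
- apply: negligibleS (negligibleU covC covC') => x nx.
  rewrite -setCI => -[[a Ca ax] [b Cb bx]]; apply: nx.
  by exists (a `&` b) => //; exists a => //; exists b.
Qed.

Section Preserved.
Context (f : Omega -> Omega).
Context (mpf : measure_preserving mu f).

Lemma measurable_preimage E : measurable E -> measurable (f @^-1` E).
Proof.
by move=> mE; rewrite -[f @^-1` E]setTI; case: mpf => + _; exact.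
Qed.

Lemma prob_preimage E : measurable E -> P (f @^-1` E) = P E.
Proof. by move=> mE; rewrite /P mpf.2. Qed.

Lemma negligible_preimage E : mu.-negligible E -> mu.-negligible (f @^-1` E).
Proof.
move=> [N [mN N0 EN]]; exists (f @^-1` N); split.
- exact: measurable_preimage.
- by rewrite mpf.2.
- exact: preimage_subset.
Qed.

Lemma partition_preimage C : countable_partition_mod mu C ->
  countable_partition_mod mu [set f @^-1` b | b in C].
Proof.
move=> [cC mC dC covC]; split.
- exact: card_le_trans (card_image_le _ _) cC.
- by move=> _ [b Cb <-]; apply: measurable_preimage; exact: mC.
- move=> _ _ [b Cb <-] [b' Cb' <-] neq; rewrite -preimage_setI.
  by apply: negligible_preimage; apply: dC => // bb'; apply: neq; rewrite bb'.
- apply: negligibleS (negligible_preimage covC) => x nx /= -[b Cb bx].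
  by apply: nx; exists (f @^-1` b) => //; exists b.
Qed.

End Preserved.

Lemma measure_preserving_iter f n : measure_preserving mu f ->
  measure_preserving mu (iter n f).
Proof.
move=> mf; elim: n => [|n [ih1 ih2]].
  by split; [exact: measurable_id|].
have [m1 m2] := mf; split.
  exact: (measurableT_comp m1 ih1).
move=> E mE.
rewrite (_ : iter n.+1 f @^-1` E = iter n f @^-1` (f @^-1` E))//.
by rewrite ih2 ?m2//; exact: measurable_preimage.
Qed.

End Probability.

(** * Cylinders and their images under the iterates of the map *)

Section Cylinders.
Context (R : realType) (d : measure_display) (Omega : measurableType d).
Context (mu : probability Omega R) (T : Omega -> Omega).
Context (alpha : set (set Omega)).
Context (palpha : countable_partition_mod mu alpha).
Context (mpT : measure_preserving mu T).
Implicit Types (a b c E F : set Omega).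
Local Notation P := (prob mu).
Local Notation cyl := (joined T alpha).

Lemma measurable_iter n E : measurable E -> measurable (iter n T @^-1` E).
Proof. exact: (measurable_preimage (measure_preserving_iter n mpT)). Qed.

Lemma prob_iter n E : measurable E -> P (iter n T @^-1` E) = P E.
Proof. exact: (prob_preimage (measure_preserving_iter n mpT)). Qed.

Lemma preimage_iterD m n E :
  iter (m + n) T @^-1` E = iter m T @^-1` (iter n T @^-1` E).
Proof.
by apply/seteqP; split => x /=; rewrite addnC iterD.
Qed.

Lemma joinedS n :
  cyl n.+1 = joinp (cyl n) [set iter n T @^-1` a | a in alpha].
Proof.
apply/seteqP; split.
  move=> _ [a ha ->]; exists (\bigcap_(i in `I_n) (iter i T @^-1` a i)).
    by exists a => // i /ltnW; exact: ha.
  exists (iter n T @^-1` a n); first by exists (a n) => //; exact: ha.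
  by rewrite !bigcap_mkord big_ord_recr.
move=> _ [_ [a ha ->] [_ [c hc <-] <-]].
exists (fun i => if (i < n)%N then a i else c).
  by move=> i _; case: ifPn => // /ha.
rewrite !bigcap_mkord big_ord_recr/= ltnn; congr (_ `&` _).
by apply: eq_bigr => i _; rewrite ltn_ord.
Qed.

Lemma joined0 : cyl 0 = [set setT].
Proof.
have I0 (F : nat -> set Omega) : \bigcap_(i in `I_0) F i = setT.
  by rewrite bigcap_mkord big_ord0.
apply/seteqP; split => [_ [a _ ->]|_ ->]; first by rewrite I0.
by exists (fun=> setT) => //; rewrite I0.
Qed.

Lemma joined1 : cyl 1 = alpha.
Proof.
rewrite joinedS joined0; apply/seteqP; split.
  by move=> _ [_ -> [_ [c hc <-] <-]]; rewrite setTI.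
move=> a ha; exists setT => //; exists (iter 0 T @^-1` a); first by exists a.
by rewrite setTI.
Qed.

Lemma partition_joined n : countable_partition_mod mu (cyl n).
Proof.
elim: n => [|n ih].
  rewrite joined0; split; first exact: countable1.
  - by move=> _ ->.
  - by move=> _ _ -> ->.
  - rewrite bigcup_set1 setCT; exact: negligible_set0.
rewrite joinedS; apply: partition_join => //.
by apply: partition_preimage => //; exact: measure_preserving_iter.
Qed.

Lemma measurable_joined n a : cyl n a -> measurable a.
Proof. by have [_ + _ _] := partition_joined n; exact. Qed.

Lemma measurable_part a : alpha a -> measurable a.
Proof. by have [_ + _ _] := palpha; exact. Qed.


Lemma joinedD m n a b : cyl m a -> cyl n b ->
  cyl (m + n) (a `&` iter m T @^-1` b).
Proof.
elim: n b => [|n ih] b ha.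
  by rewrite joined0 => ->; rewrite preimage_setT setIT addn0.
rewrite joinedS => -[b' hb' [_ [c hc <-] <-]].
rewrite preimage_setI setIA -preimage_iterD addnS joinedS.
exists (a `&` iter m T @^-1` b'); first exact: ih.
by exists (iter (m + n) T @^-1` c) => //; exists c.
Qed.

Context (markov : forall a, alpha a ->
  (exists2 B, <<s alpha >> B & eq_mod mu (T @` a) B) /\
  invertible_nonsingular_on mu T a).

Lemma image_part a E : alpha a -> measurable E -> E `<=` a ->
  measurable (T @` E) /\ (P (T @` E) = 0 <-> P E = 0).
Proof.
move=> ha mE Ea; have [_ [_ mT nT]] := markov ha.
have mTE := mT _ mE Ea; split => //.
have := nT _ mE Ea; rewrite !probE//.
by case=> h1 h2; split=> [h|h]; apply: EFin_inj; [apply: h1|apply: h2]; rewrite h.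
Qed.

Lemma iterS_image n E : iter n.+1 T @` E = T @` (iter n T @` E).
Proof. by rewrite -image_comp. Qed.

(** Induction on the last symbol [c]: the image at the previous time lies inside [c], where [T] is
    invertible and nonsingular. *)
Lemma image_joined n a E : cyl n a -> measurable E -> E `<=` a ->
  measurable (iter n T @` E) /\ (P (iter n T @` E) = 0 <-> P E = 0).
Proof.
elim: n a E => [|n ih] a E; first by rewrite image_id.
rewrite joinedS iterS_image => -[a' ha' [_ [c hc <-] <-]] mE.
rewrite subsetI => -[Ea' Ec].
have [mTE TE0] := ih _ _ ha' mE Ea'.
have TEc : iter n T @` E `<=` c by move=> _ [x Ex <-]; exact: Ec.
have [mTTE TTE0] := image_part hc mTE TEc.
by split => //; rewrite TTE0.
Qed.

Lemma dichotomic_eq (C : set (set Omega)) B B' :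
  (forall b, C b -> measurable b) -> dichotomic mu C B ->
  measurable B' -> P (B `\` B') = 0 -> P (B' `\` B) = 0 -> dichotomic mu C B'.
Proof.
move=> mC [mB dB] mB' BB' B'B; split=> // b Cb; have mb := mC _ Cb.
have [h|h] := dB _ Cb; [left|right]; apply: prob_null; do ?exact: measurableI;
  do ?exact: measurableD.
- have mbB := measurableI _ _ mb mB; have mB'B := measurableD mB' mB.
  apply: negligibleS (negligibleU (null_prob mbB h) (null_prob mB'B B'B)) => x.
  by move=> [bx B'x]; case: (pselect (B x)); [left|right].
- have mbB := measurableD mb mB; have mBB' := measurableD mB mB'.
  apply: negligibleS (negligibleU (null_prob mbB h) (null_prob mBB' BB')) => x.
  by move=> [bx B'x]; case: (pselect (B x)); [right|left].
Qed.

Lemma image_part_dichotomic a : alpha a -> dichotomic mu alpha (T @` a).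
Proof.
move=> ha; have [[B hB eqB] _] := markov ha.
have [mTa _] := image_part ha (measurable_part ha) (@subset_refl _ a).
have dB := generated_dichotomic palpha hB; have [mB _] := dB.
apply: (dichotomic_eq _ dB) => //; first exact: measurable_part.
  apply: prob_null; first exact: measurableD.
  by apply: negligibleS eqB; exact: subsetUr.
apply: prob_null; first exact: measurableD.
by apply: negligibleS eqB; exact: subsetUl.
Qed.

(** The Markov property: the image of a non-null cylinder is that of its last symbol [c], mod [mu].
    Indeed the image at the previous time is a union of cells, so it covers [c] or misses it mod
    [mu], and missing it would make the cylinder null by nonsingularity. *)
Lemma image_joined_full n a : cyl n.+1 a -> P a <> 0 ->
  dichotomic mu alpha (iter n.+1 T @` a) /\
  exists2 c, alpha c & P (T @` c `\` iter n.+1 T @` a) = 0.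
Proof.
have step m a' c : cyl m a' -> alpha c ->
    dichotomic mu alpha (iter m T @` a') ->
    P (a' `&` iter m T @^-1` c) <> 0 ->
    dichotomic mu alpha (iter m.+1 T @` (a' `&` iter m T @^-1` c)) /\
    P (T @` c `\` iter m.+1 T @` (a' `&` iter m T @^-1` c)) = 0.
  move=> ha' hc [mTa' da'] ne0; set a0 := a' `&` _.
  have mc := measurable_part hc.
  have Ta0 : iter m T @` a0 = c `&` iter m T @` a'.
    apply/seteqP; split=> [_ [x [a'x cx] <-]|x [cx [y a'y yx]]].
      by split=> //; exists x.
    by exists y => //; split=> //=; rewrite yx.
  have ma0 : measurable a0.
    apply: measurableI; [exact: measurable_joined ha'|exact: measurable_iter].
  have [mTa0 Ta00] := image_joined ha' ma0 (@subIsetl _ _ _).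
  have [c0|c0] := da' _ hc; first by case: ne0; apply/Ta00; rewrite Ta0.
  have [mTTa0 _] := image_part hc mTa0 (eq_ind_r (fun X => X `<=` c) (@subIsetl _ _ _) Ta0).
  have mD : measurable (c `\` iter m T @` a') by exact: measurableD.
  have [mTD TD0] := image_part hc mD (@subDsetl _ _ _).
  have [mTc _] := image_part hc mc (@subset_refl _ c).
  have D0 : P (T @` c `\` iter m.+1 T @` a0) = 0.
    apply: (prob_subnull _ mTD _ (TD0.2 c0)).
      by apply: measurableD => //; rewrite iterS_image.
    move=> _ [[x cx <-] nx]; exists x => //; split=> // Tx.
    by apply: nx; rewrite iterS_image Ta0; exists x.
  split=> //; apply: (dichotomic_eq _ (image_part_dichotomic hc)) => //.
  - exact: measurable_part.
  - by rewrite iterS_image.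
  - rewrite [X in P X](_ : _ = set0) ?prob_set0// iterS_image.
    apply/seteqP; split=> // x [[y]]; rewrite Ta0 => -[cy _] <- []; by exists y.
have base m a' : cyl m a' -> P a' <> 0 -> dichotomic mu alpha (iter m T @` a').
  elim: m a' => [|m ih] a'.
    rewrite joined0 => -> _; rewrite image_id; split=> // b _; right.
    by rewrite setDT prob_set0.
  rewrite joinedS => -[a0 ha0 [_ [c hc <-] <-]] ne0.
  apply: (step m a0 c ha0 hc _ ne0).1; apply: ih => // a00; apply: ne0.
  apply: prob_subnull a00.
  - apply: measurableI; first exact: measurable_joined ha0.
    by apply: measurable_iter; exact: measurable_part.
  - exact: measurable_joined ha0.
  - exact: subIsetl.
move=> ha ne0; split; first exact: base.
move: ha ne0; rewrite joinedS => -[a' ha' [_ [c hc <-] <-]] ne0.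
exists c => //; apply: (step n a' c ha' hc _ ne0).2; apply: base => // a00.
apply: ne0; apply: prob_subnull a00.
- apply: measurableI; first exact: measurable_joined ha'.
  by apply: measurable_iter; exact: measurable_part.
- exact: measurable_joined ha'.
- exact: subIsetl.
Qed.

End Cylinders.

(** * Distortion estimates for cylinders *)

Section GibbsMarkovMixing.
Context (R : realType) (d : measure_display) (Omega : measurableType d).
Context (mu : probability Omega R) (T : Omega -> Omega).
Context (alpha : set (set Omega)).
Context (palpha : countable_partition_mod mu alpha).
Context (mpT : measure_preserving mu T).
Context (markov : forall a, alpha a ->
  (exists2 B, <<s alpha >> B & eq_mod mu (T @` a) B) /\
  invertible_nonsingular_on mu T a).
Context (r M : R) (r_gt0 : 0 < r) (r_lt1 : r < 1) (M_gt0 : 0 < M).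
Context (dist : forall (n : nat) (a : set Omega), (0 < n)%N ->
  joined T alpha n a ->
  exists (v : Omega -> Omega) (v' : Omega -> R),
    [/\ inverse_branch T n a v,
        RN_derivative_on mu (iter n T @` a) v v' &
        {ae mu, forall x, (iter n T @` a) x ->
        {ae mu, forall y, (iter n T @` a) y ->
          `|v' x / v' y - 1| <= M * sep_dist T alpha r x y}}]).
Implicit Types (a b c E F G H : set Omega).
Local Notation P := (prob mu).
Local Notation cyl := (joined T alpha).

Lemma sep_dist_le1 x y : sep_dist T alpha r x y <= 1.
Proof.
rewrite /sep_dist; case: pselect => // h.
by rewrite exprn_ile1// ltW.
Qed.

Lemma overlap_negligible :
  mu.-negligible (\bigcup_(a in alpha)
    \bigcup_(b in alpha `&` [set b | b <> a]) (a `&` b)).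
Proof.
have [g [gC dg gP _]] := partition_enum palpha.
have [_ mC dC _] := palpha.
have : mu.-negligible (\bigcup_m \bigcup_n
    (if m == n then set0 else g m `&` g n)).
  apply: negligible_bigcup => m; apply: negligible_bigcup => n.
  case: eqP => mn; first exact: negligible_set0.
  apply: null_prob; last exact: dg.
  by apply: measurableI; [case: (gC m) => [/mC|->]|case: (gC n) => [/mC|->]].
apply: negligibleS => x [a ha [b [hb ba] [ax bx]]].
have [m am] := gP _ ha; have [n bn] := gP _ hb.
exists m => //; exists n => //; case: eqP => [mn|_]; last by rewrite -am -bn.
by case: ba; rewrite am bn mn.
Qed.

(** The exceptional set consists of the points whose orbit enters an overlap of two cells. Elsewhere
    symbols are unique, so two points of a q-cylinder cannot separate during the first q times. *)
Lemma sep_dist_joined q b : cyl q b -> exists2 N, mu.-negligible N &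
  forall x y, b x -> b y -> ~ N x -> ~ N y -> sep_dist T alpha r x y <= r ^+ q.
Proof.
move=> [c hc ->]; set N0 := \bigcup_(a in alpha)
  \bigcup_(b in alpha `&` [set b | b <> a]) (a `&` b).
exists (\bigcup_i iter i T @^-1` N0).
  apply: negligible_bigcup => i; apply: negligible_preimage.
    exact: measure_preserving_iter.
  exact: overlap_negligible.
move=> x y bx by_ Nx Ny; rewrite /sep_dist; case: pselect => [h|_]; last first.
  by rewrite exprn_ge0// ltW.
apply: ler_wiXn2l; rewrite ?(ltW r_gt0) ?(ltW r_lt1)//.
case: ex_minnP => n /andP[n0 /asboolP[a [b' [ha hb' ab' ax b'y]]]] _.
rewrite leqNgt; apply/negP => nq.
have n1q : (n.-1 < q)%N by rewrite (leq_ltn_trans (leq_pred n)).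
have cx := bx _ n1q; have cy := by_ _ n1q; have cn := hc _ n1q.
case: (pselect (a = c n.-1)) => [ac|ac].
  apply: Ny; exists n.-1 => //; exists (c n.-1) => //; exists b' => //.
  by split=> // b'c; apply: ab'; rewrite b'c.
by apply: Nx; exists n.-1 => //; exists (c n.-1) => //; exists a.
Qed.

(** Turns the Radon-Nikodym identity for [v] into a statement on preimages, from which the branch
    has disappeared. *)
Lemma inverse_branch_image n a E v : inverse_branch T n a v ->
  E `<=` iter n T @` a -> v @` E = a `&` iter n T @^-1` E.
Proof.
move=> hv ED; apply/seteqP; split.
  move=> _ [y Ey <-]; have [x ax xy] := ED _ Ey.
  by rewrite -xy hv//=; split => //; rewrite /= xy.
by move=> x [ax Ex]; exists (iter n T x) => //; exact: hv.
Qed.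

Lemma measurable_image_joined n a : cyl n a -> measurable (iter n T @` a).
Proof.
move=> ha; have ma := measurable_joined palpha mpT ha.
by have [] := image_joined markov ha ma (@subset_refl _ a).
Qed.

(** Integrate v'(x) <= (1 + kap) v'(y) over x in E and y in H: the integral of v' over a subset X of
    the image is the measure of the part of [a] sent into X. *)
Lemma distortion_compare n a E H (kap : R) : (0 < n)%N -> cyl n a ->
  measurable E -> measurable H ->
  E `<=` iter n T @` a -> H `<=` iter n T @` a -> 0 <= kap ->
  (exists2 N, mu.-negligible N & forall x y, E x -> H y -> ~ N x -> ~ N y ->
     M * sep_dist T alpha r x y <= kap) ->
  P (a `&` iter n T @^-1` E) * P H <=
    (1 + kap) * P E * P (a `&` iter n T @^-1` H).
Proof.
move=> n0 ha mE mH ED HD kap0 [N nN hN].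
have [v [v' [hv [mv' v'0 intv'] hdist]]] := dist n0 ha.
set D := iter n T @` a in ED HD mv' v'0 intv' hdist.
have mD : measurable D by exact: measurable_image_joined.
have ma := measurable_joined palpha mpT ha.
have maI X : measurable X -> measurable (a `&` iter n T @^-1` X).
  by move=> mX; apply: measurableI => //; exact: (measurable_iter mpT).
have intE X : measurable X -> X `<=` D ->
    (\int[mu]_(x in X) (v' x)%:E = (P (a `&` iter n T @^-1` X))%:E)%E.
  move=> mX XD; rewrite -intv'// (inverse_branch_image hv XD) probE//.
  exact: maI.
have mv'S X : measurable X -> X `<=` D -> measurable_fun X (fun x => (v' x)%:E).
  move=> mX XD; apply: measurableT_comp => //.
  exact: measurable_funS mD XD mv'.
(* Nonsingularity excludes zeros of v', where v' x / v' y = 0 would make the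
   distortion bound void. *)
pose Z := D `&` v' @^-1` [set 0].
have mZ : measurable Z by apply: mv' => //.
have ZD : Z `<=` D by exact: subIsetl.
have Z0 : P Z = 0.
  have aZ0 : P (a `&` iter n T @^-1` Z) = 0.
    apply: EFin_inj; rewrite -intE//; apply: integral0_eq => x [_ ->]//.
  have <- : iter n T @` (a `&` iter n T @^-1` Z) = Z.
    apply/seteqP; split; first by move=> _ [x [ax Zx] <-].
    by move=> y Zy; have [x ax xy] := ZD _ Zy; exists x => //; split=> //=; rewrite xy.
  by have [_ TZ0] := image_joined markov ha (maI _ mZ) (@subIsetl _ _ _); apply/TZ0.
have nZ : {ae mu, forall x, ~ Z x}.
  by have := null_prob mZ Z0; apply: negligibleS => x /=; exact: contrapT.
have nNN : {ae mu, forall x, ~ N x}.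
  by apply: negligibleS nN => x /=; exact: contrapT.
(* First integration, over y in H with x fixed. *)
have main : {ae mu, forall x, E x ->
    ((v' x * P H)%:E <= ((1 + kap) * P (a `&` iter n T @^-1` H))%:E)%E}.
  near=> x => Ex.
  have Dx := ED _ Ex.
  have Nx : ~ N x by near: x.
  have hx : {ae mu, forall y, D y -> `|v' x / v' y - 1| <= M * sep_dist T alpha r x y}.
    by move: (Dx); near: x.
  have vx0 := v'0 _ Dx.
  rewrite 2!EFinM -intE// -probE// -integral_cst//.
  rewrite -ge0_integralZl_EFin//; last 3 first.
  - by move=> y Hy; rewrite lee_fin; apply: v'0; exact: HD.
  - exact: mv'S.
  - by rewrite addr_ge0.
  apply: ae_ge0_le_integral => //.
  - by move=> y Hy; rewrite mule_ge0// lee_fin ?addr_ge0//; apply: v'0; exact: HD.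
  - apply: measurable_funeM; exact: mv'S.
  near=> y => Hy.
  have Dy := HD _ Hy.
  have Zy : ~ Z y by near: y.
  have Ny : ~ N y by near: y.
  have vy0 : 0 < v' y.
    rewrite lt_neqAle v'0// andbT eq_sym; apply/eqP => vy.
    by apply: Zy.
  have : `|v' x / v' y - 1| <= M * sep_dist T alpha r x y by move: (Dy); near: y.
  move/le_trans => /(_ _ (hN _ _ Ex Hy Nx Ny)).
  rewrite ler_norml => /andP[_].
  by rewrite lerBlDr ler_pdivrMr// -EFinM lee_fin addrC.
(* Second integration, over x in E. *)
have : (\int[mu]_(x in E) (v' x * P H)%:E <=
       \int[mu]_(x in E) ((1 + kap) * P (a `&` iter n T @^-1` H))%:E)%E.
  apply: ae_ge0_le_integral => //.
  - by move=> x Ex; rewrite lee_fin mulr_ge0 ?prob_ge0//; apply: v'0; exact: ED.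
  - under eq_fun do rewrite mulrC EFinM.
    by apply: measurable_funeM; exact: mv'S.
  - by move=> x Ex; rewrite lee_fin !mulr_ge0 ?prob_ge0// addr_ge0.
under eq_integral do rewrite mulrC EFinM.
rewrite ge0_integralZl_EFin//; last 3 first.
- by move=> x Ex; rewrite lee_fin; apply: v'0; exact: ED.
- exact: mv'S.
- exact: prob_ge0.
rewrite intE// integral_cst// [X in (_ <= _ * X)%E](probE mu mE) -!EFinM lee_fin.
by move=> h; rewrite mulrC (le_trans h)// mulrAC.
Unshelve. all: by end_near. Qed.

(** Compare the whole image D with the part of E inside it, using only that the separation distance
    is at most 1; the factor P(D) is then bounded by 1. *)
Lemma distortion_image n a E : (0 < n)%N -> cyl n a -> measurable E ->
  P a * P (E `&` iter n T @` a) <= (1 + M) * P (a `&` iter n T @^-1` E).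
Proof.
move=> n0 ha mE; set D := iter n T @` a.
have mD : measurable D by exact: measurable_image_joined.
have ma := measurable_joined palpha mpT ha.
have mED : measurable (E `&` D) by exact: measurableI.
have := @distortion_compare n a D (E `&` D) M n0 ha mD mED (@subset_refl _ D)
  (@subIsetr _ _ _) (ltW M_gt0) _.
have aD X : a `&` iter n T @^-1` (X `&` D) = a `&` iter n T @^-1` X.
  by apply/seteqP; split=> x [ax]; [case|split=> //; split=> //; exists x].
have -> : a `&` iter n T @^-1` D = a.
  by rewrite -[D]setTI aD preimage_setT setIT.
rewrite aD => /(_ _) h; apply: le_trans (h _) _.
  exists set0; first exact: negligible_set0.
  by move=> x y _ _ _ _; rewrite ler_piMr ?sep_dist_le1 ?(ltW M_gt0).
have maE : measurable (a `&` iter n T @^-1` E).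
  by apply: measurableI => //; exact: (measurable_iter mpT).
rewrite -mulrA ler_wpM2l ?ler_piMl ?prob_ge0 ?prob_le1//.
by rewrite addr_ge0// ltW.
Qed.

(** Once the next q symbols are fixed by [b], the density of the image law varies at most by the
    factor 1 + M r^q. This yields conditional probabilities given [b], written without division. *)
Lemma distortion_upper n a q b E : (0 < n)%N -> cyl n a -> (0 < q)%N ->
  cyl q b -> measurable E -> E `<=` b ->
  P (a `&` iter n T @^-1` E) * P b <=
    (1 + M * r ^+ q) * P E * P (a `&` iter n T @^-1` b).
Proof.
move=> n0 ha q0 hb mE Eb; set D := iter n T @` a.
have mD : measurable D by exact: measurable_image_joined.
have ma := measurable_joined palpha mpT ha.
have mb := measurable_joined palpha mpT hb.
have maI X : measurable X -> measurable (a `&` iter n T @^-1` X).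
  by move=> mX; apply: measurableI => //; exact: (measurable_iter mpT).
have k0 : 0 <= M * r ^+ q by rewrite mulr_ge0 ?exprn_ge0 ?ltW.
have rhs0 : 0 <= (1 + M * r ^+ q) * P E * P (a `&` iter n T @^-1` b).
  by rewrite !mulr_ge0 ?prob_ge0// addr_ge0.
have aD X : a `&` iter n T @^-1` (X `&` D) = a `&` iter n T @^-1` X.
  by apply/seteqP; split=> x [ax]; [case|split=> //; split=> //; exists x].
have null : P (a `&` iter n T @^-1` b) = 0 -> P (a `&` iter n T @^-1` E) = 0.
  apply: prob_subnull; [exact: maI|exact: maI|].
  by apply: setIS; exact: preimage_subset.
case: (eqVneq (P a) 0) => [a0|/eqP a0].
  rewrite (_ : P (a `&` _) = 0) ?mul0r//.
  by apply: prob_subnull a0 => //; exact: maI.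
case: n n0 ha @D mD maI rhs0 aD null => // n _ ha D mD maI rhs0 aD null.
have [dD _] := image_joined_full palpha mpT markov ha a0.
have [c hc hb'] : exists2 c, alpha c & b `<=` c.
  have [c hc ->] := hb; exists (c 0%N); first exact: hc.
  by move=> x /(_ _ q0).
have mc := measurable_part palpha hc.
(* The image D is a union of cells mod [mu] and [b] lies in one cell, so D covers [b] as soon as it
   meets it in positive measure. *)
have bD : P (a `&` iter n.+1 T @^-1` b) <> 0 -> P (b `\` D) = 0.
  move=> ne0; have [h|h] := dD.2 _ hc; last first.
    apply: prob_subnull h; [exact: measurableD|exact: measurableD|].
    by move=> x [bx Dx]; split=> //; exact: hb'.
  case: ne0; have [mTX TX0] := image_joined markov ha (maI _ mb) (@subIsetl _ _ _).
  apply/TX0; apply: prob_subnull h => //; first exact: measurableI.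
  move=> _ [x [ax bx] <-]; split; first exact: hb'.
  by exists x.
case: (eqVneq (P (a `&` iter n.+1 T @^-1` b)) 0) => [h|/eqP /bD h].
  by rewrite (null h) mul0r.
have := @distortion_compare n.+1 a (E `&` D) (b `&` D) (M * r ^+ q) isT ha
  (measurableI _ _ mE mD) (measurableI _ _ mb mD) (@subIsetr _ _ _)
  (@subIsetr _ _ _) k0.
rewrite !aD (prob_setI_full mb mD h) (prob_setI_full mE mD); last first.
  by apply: prob_subnull h; [exact: measurableD|exact: measurableD|exact: setSD].
apply; have [N nN hN] := sep_dist_joined hb; exists N => // x y [Ex _] [by_ _] Nx Ny.
by rewrite ler_pM2l// hN//; exact: Eb.
Qed.

(** Apply [distortion_upper] to the complement of E in [b]. *)
Lemma distortion_lower n a q b E : (0 < n)%N -> cyl n a -> (0 < q)%N ->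
  cyl q b -> measurable E -> E `<=` b ->
  (P E - M * r ^+ q * P b) * P (a `&` iter n T @^-1` b) <=
  P (a `&` iter n T @^-1` E) * P b.
Proof.
move=> n0 ha q0 hb mE Eb.
have ma := measurable_joined palpha mpT ha.
have mb := measurable_joined palpha mpT hb.
have maI X : measurable X -> measurable (a `&` iter n T @^-1` X).
  by move=> mX; apply: measurableI => //; exact: (measurable_iter mpT).
have mbE : measurable (b `\` E) by exact: measurableD.
have := distortion_upper n0 ha q0 hb mbE (@subDsetl _ _ _).
have : P b = P E + P (b `\` E).
  by rewrite [LHS](prob_splitI mu mb mE) (setIidr Eb).
have : P (a `&` iter n T @^-1` b) =
    P (a `&` iter n T @^-1` E) + P (a `&` iter n T @^-1` (b `\` E)).
  rewrite [LHS](prob_splitI mu (maI _ mb) (measurable_iter mpT n mE)).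
  congr (P _ + P _); apply/seteqP; split => x.
  - by move=> [[]].
  - by move=> [ax Ex]; split=> //; split=> //; exact: Eb.
  - by move=> [[]].
  - by move=> [ax []].
have := prob_ge0 mu (a `&` iter n T @^-1` b).
have := prob_ge0 mu E.
have : 0 <= M * r ^+ q by rewrite mulr_ge0 ?exprn_ge0 ?ltW.
move: (M * r ^+ q) (P b) (P E) (P (b `\` E)) (P (a `&` iter n T @^-1` b))
  (P (a `&` iter n T @^-1` E)) (P (a `&` iter n T @^-1` (b `\` E))).
move=> k pb pE pbE pab paE pabE k0 E0 ab0 abE bE h.
have : 0 <= k * pE * pab by rewrite !mulr_ge0.
by move: h; rewrite bE abE; lra.
Qed.


(** * Doeblin minorization and contraction of the spread *)

Context (mixing : topologically_mixing mu T alpha).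
Context (big : Defs.big_image mu T alpha).

Let mcyl n a (ha : cyl n a) := measurable_joined palpha mpT ha.
Let mpart a (ha : alpha a) := measurable_part palpha ha.
Let mpre n E (mE : measurable E) := measurable_iter mpT n mE.

Lemma joined_sub_part n a : (0 < n)%N -> cyl n a -> exists2 c, alpha c & a `<=` c.
Proof.
by move=> n0 [c hc ->]; exists (c 0%N); [exact: hc|move=> x /(_ _ n0)].
Qed.

Lemma disjoint_parts a b : alpha a -> alpha b -> a <> b -> P (a `&` b) = 0.
Proof.
move=> ha hb ab; have [_ _ dalpha _] := palpha.
by apply: prob_null; [apply: measurableI; exact: mpart|exact: dalpha].
Qed.

Lemma exists_part_pos : exists2 b, alpha b & P b <> 0.
Proof.
apply: contrapT => /forall2NP h.
suff : P (setT `&` setT) <= 0 by rewrite setIT probT ler10.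
apply: (partition_le0 palpha (null_additive_prob mu measurableT)) => b hb.
by rewrite setTI; case: (h b) => [/(_ hb)|/contrapT ->].
Qed.

Lemma big_image_lower : exists2 dl : R, 0 < dl &
  forall a, alpha a -> dl <= P (T @` a).
Proof.
have := big; rewrite /Defs.big_image.
set S := ereal_inf _ => S0.
have SP a : alpha a -> (S <= (P (T @` a))%:E)%E.
  move=> ha; have [mTa _] := image_part markov ha (mpart ha) (@subset_refl _ a).
  by rewrite -probE//; apply: ereal_inf_lbound; exists a.
move: S S0 SP => [s| |]// S0 SP.
- by exists s => // a /SP; rewrite lee_fin.
- by exists 1 => // a /SP.
Qed.

(* T^n b is a union of images of n-cylinders, and each image that meets b1
   covers it mod mu. *)
Lemma reach n b b1 : (0 < n)%N -> alpha b -> alpha b1 -> P b1 <> 0 ->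
  sub_image_mod mu T n b b1 ->
  exists2 c : R, 0 < c & forall F, measurable F ->
    c * P (F `&` b1) <= P (b `&` iter n T @^-1` F).
Proof.
move=> n0 hb hb1 b10 sub.
have [g [gC _ _ gcov]] := partition_enum (partition_joined palpha mpT n).
have mg k : measurable (g k) by case: (gC k) => [/mcyl|->].
have nN : mu.-negligible (~` \bigcup_k g k).
  by apply: null_prob => //; apply: measurableC; exact: bigcup_measurable.
have sub0 := sub _ nN.
(* Mixing is used with the null set missed by all n-cylinders removed from [b]; almost every point
   of [b1] is then reached from some [g k], so one of them reaches a non-null part. *)
have [k gk ne0] : exists2 k, cyl n (g k) &
    P (b1 `&` iter n T @` (b `&` g k)) <> 0.
  apply: contrapT => /forall2NP h; apply: b10; apply: prob_null; first exact: mpart.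
  have : mu.-negligible (\bigcup_k (b1 `&` iter n T @` (b `&` g k))).
    apply: negligible_bigcup => k; case: (gC k) => [gk|->]; last first.
      by rewrite setI0 image_set0 setI0; exact: negligible_set0.
    have mbg : measurable (b `&` g k) by apply: measurableI => //; exact: mpart.
    have [mTX _] := image_joined markov gk mbg (@subIsetr _ _ _).
    apply: null_prob; first by apply: measurableI => //; exact: mpart.
    by case: (h k) => [/(_ gk)|/contrapT].
  move=> /(negligibleU sub0); apply: negligibleS => x b1x.
  case: (pselect ((iter n T @` (b `\` ~` \bigcup_k g k)) x)) => [|nx]; last by left.
  move=> [y [yb /contrapT[j _ gjy]] yx]; right; exists j => //; split=> //.
  by exists y.
have mbg : measurable (b `&` g k) by apply: measurableI => //; exact: mpart.
have [mTX TX0] := image_joined markov gk mbg (@subIsetr _ _ _).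
have bg0 : P (b `&` g k) <> 0.
  move=> /TX0 h; apply: ne0; apply: prob_subnull h => //.
  by apply: measurableI => //; exact: mpart.
(* [g k] lies in a single cell [c]; since it meets [b] in positive measure, [c] is [b]. *)
have gb : g k `<=` b.
  have [c hc gc] := joined_sub_part n0 gk.
  case: (pselect (b = c)) => [->//|bc]; case: bg0.
  apply: prob_subnull (disjoint_parts hb hc bc) => //.
    by apply: measurableI; exact: mpart.
  exact: setIS.
have bgE : b `&` g k = g k by exact: setIidr.
rewrite bgE in ne0 mTX bg0.
case: n n0 sub gC sub0 gk TX0 {nN gcov} mTX ne0 => // n n0 sub gC sub0 gk TX0 mTX ne0.
have [[mD dD] _] := image_joined_full palpha mpT markov gk bg0.
have b1D : P (b1 `\` iter n.+1 T @` g k) = 0 by case: (dD _ hb1).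
(* The constant of [distortion_image] for [g k], whose image covers [b1] mod [mu]. *)
exists (P (g k) / (1 + M)).
  by rewrite divr_gt0 ?addr_gt0// lt_neqAle prob_ge0 andbT eq_sym; exact/eqP.
move=> F mF.
have mb1 := mpart hb1; have mb := mpart hb.
have M1 : 0 < 1 + M by rewrite addr_gt0.
rewrite mulrAC ler_pdivrMr// mulrC.
have le1 : P (F `&` b1) <= P (F `&` iter n.+1 T @` g k).
  apply: le_prob_mod; [exact: measurableI|exact: measurableI|].
  apply: prob_subnull b1D.
  - by apply: measurableD; exact: measurableI.
  - exact: measurableD.
  - by move=> x [[Fx b1x] nx]; split=> // Dx; apply: nx.
have le2 := distortion_image n0 gk mF.
rewrite mulrC (le_trans (ler_wpM2l (prob_ge0 _ _) le1))// (le_trans le2)//.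
rewrite mulrC ler_wpM2r ?(ltW M1)// le_prob//.
- by apply: measurableI => //; exact: mpre.
- by apply: measurableI => //; exact: mpre.
- exact: setSI.
Qed.

(** The image of a non-null cylinder is a union of cells of measure at least [dl], so it contains
    one of finitely many cells exhausting more than 1 - dl. By mixing, all of these reach the fixed
    cell [b1] at one common time [n0]. *)
Lemma doeblin : exists n0 : nat, exists c : R, exists b1,
  [/\ 0 < c, alpha b1, P b1 <> 0 &
  forall n a F, (0 < n)%N -> cyl n a -> measurable F ->
    c * P a * P (F `&` b1) <= P (a `&` iter (n + n0) T @^-1` F)].
Proof.
have [b1 hb1 b10] := exists_part_pos.
have [dl dl0 hdl] := big_image_lower.
have [g [gC _ _ gcov]] := partition_enum palpha.
have mg k : measurable (g k) by case: (gC k) => [/mpart|->].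
pose U n := \big[setU/set0]_(i < n) g i.
have mU n : measurable (U n) by exact: bigsetU_measurable.
have UE : \bigcup_n U n = \bigcup_n g n by exact: bigcup_partial_unions.
have ndU : nondecreasing_seq U.
  by move=> m n mn; exact/subsetPset/subset_bigsetU.
(* The first N cells leave measure less than [dl], too little to hold the image of a non-null
   cylinder. *)
have [N hN] : exists N, 1 - dl < P (U N).
  have [_ _ /(_ U mU ndU)] := null_additive_prob mu measurableT.
  rewrite setTI UE.
  have -> : P (\bigcup_n g n) = 1.
    have mG : measurable (\bigcup_n g n) by exact: bigcup_measurable.
    rewrite -(probT mu) (prob_splitI mu measurableT mG) setTI setTD gcov addr0//.
  move/cvgr_gt => /(_ (1 - dl)); rewrite ltrBlDr ltrDl => /(_ dl0) [N _ /(_ N (leqnn N))].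
  by rewrite setTI /= => h; exists N.
have [n0 n00 hn0] : exists2 n0, (0 < n0)%N & forall k, (k < N)%N ->
    alpha (g k) -> sub_image_mod mu T n0 (g k) b1.
  have : forall K, exists n1, forall n, (n1 <= n)%N -> forall k, (k < K)%N ->
      alpha (g k) -> sub_image_mod mu T n (g k) b1.
    elim=> [|K [n1 ih]]; first by exists 0%N.
    case: (pselect (alpha (g K))) => [gK|gK]; last first.
      exists n1 => n n1n k; rewrite ltnS leq_eqVlt => /predU1P[->//|kK]; exact: ih.
    have [n2 _ h2] := mixing gK hb1.
    exists (maxn n1 n2) => n; rewrite geq_max => /andP[n1n n2n] k.
    rewrite ltnS leq_eqVlt => /predU1P[-> _|kK]; [exact: h2|exact: ih].
  by move=> /(_ N)[n1 h1]; exists n1.+1 => //; exact: h1.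
(* The least of the finitely many constants given by [reach]. *)
have [c c0 hc] : exists2 c : R, 0 < c & forall k, (k < N)%N -> alpha (g k) ->
    forall F, measurable F ->
    c * P (F `&` b1) <= P (g k `&` iter n0 T @^-1` F).
  have : forall K, (K <= N)%N -> exists2 c : R, 0 < c & forall k, (k < K)%N ->
      alpha (g k) -> forall F, measurable F ->
      c * P (F `&` b1) <= P (g k `&` iter n0 T @^-1` F).
    elim=> [_|K ih KN]; first by exists 1.
    have [c c0 hc] := ih (ltnW KN).
    case: (pselect (alpha (g K))) => [gK|gK]; last first.
      exists c => // k; rewrite ltnS leq_eqVlt => /predU1P[->//|kK]; exact: hc.
    have [c' c'0 hc'] := reach n00 gK hb1 b10 (hn0 _ KN gK).
    exists (Num.min c c'); first by rewrite lt_min c0.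
    move=> k kK gk F mF.
    have [kK'|kK'] : k = K \/ (k < K)%N.
      by move: kK; rewrite ltnS leq_eqVlt => /predU1P.
    - rewrite kK'; apply: le_trans (hc' _ mF).
      by rewrite ler_wpM2r ?prob_ge0// ge_min lexx orbT.
    - apply: le_trans (hc _ kK' gk _ mF).
      by rewrite ler_wpM2r ?prob_ge0// ge_min lexx.
  by move=> /(_ N (leqnn N)).
have M1 : 0 < 1 + M by rewrite addr_gt0.
exists n0, (c / (1 + M)), b1; split=> //; first by rewrite divr_gt0.
move=> n a F np ha mF.
have mb1 := mpart hb1; have ma := mcyl ha.
have [a0|/eqP a0] := eqVneq (P a) 0; first by rewrite a0 mulr0 mul0r prob_ge0.
case: n np ha => // n np ha.
have [[mD dD] [c1 hc1 Dc1]] := image_joined_full palpha mpT markov ha a0.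
set D := iter n.+1 T @` a in mD dD Dc1.
have [mTc _] := image_part markov hc1 (mpart hc1) (@subset_refl _ c1).
have Ddl : dl <= P D by apply: le_trans (hdl _ hc1) _; exact: le_prob_mod.
have [k kN [gk gkD]] : exists2 k, (k < N)%N & alpha (g k) /\ P (g k `\` D) = 0.
  apply: contrapT => /forall2NP h.
  have DU0 : P (D `&` U N) = 0.
    apply: prob_bigsetU_null => // i iN.
    rewrite setIC; case: (gC i) => [gi|->]; last by rewrite set0I prob_set0.
    have [//|giD] := dD _ gi.
    by case: (h i) => [/(_ iN)|/(_ (conj gi giD))].
  have := prob_splitI mu mD (mU N); rewrite DU0 add0r => DE.
  have : P (D `\` U N) <= P (~` U N).
    by apply: le_prob; [exact: measurableD|exact: measurableC|move=> x []].
  have := prob_splitI mu measurableT (mU N); rewrite probT setTI setTD.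
  by move=> ? ?; lra.
have mX := mpre n0 mF.
have le1 : P (iter n0 T @^-1` F `&` g k) <= P (iter n0 T @^-1` F `&` D).
  apply: le_prob_mod; [exact: measurableI|exact: measurableI|].
  apply: prob_subnull gkD.
  - by apply: measurableD; exact: measurableI.
  - exact: measurableD.
  - by move=> x [[Fx gx] nx]; split=> // Dx; apply: nx.
have le2 := distortion_image np ha mX.
have le3 := hc _ kN gk _ mF.
rewrite preimage_iterD.
have -> : c / (1 + M) * P a * P (F `&` b1) = c * P (F `&` b1) * P a / (1 + M).
  by rewrite -!mulrA; congr (_ * _); rewrite mulrC -mulrA mulrCA.
rewrite ler_pdivrMr// [leRHS]mulrC; apply: le_trans le2.
rewrite mulrC ler_wpM2l ?prob_ge0//; apply: le_trans le1.
by rewrite [X in _ <= P X]setIC.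
Qed.

(** The conditional probabilities of F after a gap p, given any cylinder of any length, lie in one
    interval of length [dl]. Leaving its endpoint [I] free makes the property suitable for
    iteration; it is compared with P(F) only in [quasi_independent_decay]. *)
Definition quasi_independent (p : nat) (dl : R) := forall F, measurable F ->
  exists I : R, forall n a, (0 < n)%N -> cyl n a ->
    I * P a <= P (a `&` iter (n + p) T @^-1` F) <= (I + dl) * P a.

Lemma quasi_independent0 : quasi_independent 0 1.
Proof.
move=> F mF; exists 0 => n a n0 ha; rewrite mul0r prob_ge0/= add0r mul1r.
have ma := mcyl ha; apply: le_prob => //.
by apply: measurableI => //; exact: mpre.
Qed.

(** The distortion bounds hold for each cylinder of length n + m that refines [a]; summing over the
    m intermediate symbols keeps them. *)
Lemma forget_past n a m q b E : (0 < n)%N -> cyl n a -> (0 < q)%N ->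
  cyl q b -> measurable E -> E `<=` b ->
  P (a `&` iter (n + m) T @^-1` E) * P b <=
    (1 + M * r ^+ q) * P E * P (a `&` iter (n + m) T @^-1` b) /\
  (P E - M * r ^+ q * P b) * P (a `&` iter (n + m) T @^-1` b) <=
    P (a `&` iter (n + m) T @^-1` E) * P b.
Proof.
move=> n0 ha q0 hb mE Eb.
have pw := partition_preimage (measure_preserving_iter n mpT)
  (partition_joined palpha mpT m).
have nm0 : (0 < n + m)%N by rewrite addn_gt0 n0.
have maI X : measurable X -> measurable (a `&` iter (n + m) T @^-1` X).
  by move=> mX; apply: measurableI; [exact: mcyl ha|exact: mpre].
have naE := null_additive_prob mu (maI _ mE).
have nab := null_additive_prob mu (maI _ (mcyl hb)).
split; rewrite -subr_le0.
- suff : P b * P (a `&` iter (n + m) T @^-1` E `&` setT) +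
      - ((1 + M * r ^+ q) * P E) * P (a `&` iter (n + m) T @^-1` b `&` setT) <= 0.
    by rewrite !setIT mulNr [P b * _]mulrC.
  apply: (partition_le0 pw (null_additiveD (null_additiveZ (P b) naE)
    (null_additiveZ (- ((1 + M * r ^+ q) * P E)) nab))) => _ [w hw <-].
  have haw := joinedD ha hw.
  have := distortion_upper nm0 haw q0 hb mE Eb.
  by rewrite -subr_le0 setIAC [X in _ - _ * P X]setIAC mulNr [P b * _]mulrC.
- suff : (P E - M * r ^+ q * P b) * P (a `&` iter (n + m) T @^-1` b `&` setT) +
      - P b * P (a `&` iter (n + m) T @^-1` E `&` setT) <= 0.
    by rewrite !setIT mulNr [P b * _]mulrC.
  apply: (partition_le0 pw (null_additiveD
    (null_additiveZ (P E - M * r ^+ q * P b) nab)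
    (null_additiveZ (- P b) naE))) => _ [w hw <-].
  have haw := joinedD ha hw.
  have := distortion_lower nm0 haw q0 hb mE Eb.
  by rewrite -subr_le0 setIAC [X in _ - P X * _]setIAC mulNr [P b * _]mulrC.
Qed.

(** Split the mass m on [b] into the common part kb and the rest. The common part contributes
    exactly kg, the rest at most S (m - kb), and the distortion at most eps m. *)
Lemma convex_upper (pb pg m mg kb kg S eps : R) : 0 < pb -> 0 <= eps -> 0 <= m ->
  kb * pg = kg * pb -> kb <= m -> mg * pb <= (1 + eps) * pg * m ->
  pg <= S * pb -> pg <= pb -> mg + S * kb <= kg + (S + eps) * m.
Proof.
move=> pb0 eps0 m0 kE km mgE pgS pgb.
rewrite -(ler_pM2r pb0) !mulrDl -kE.
have h1 : 0 <= (m - kb) * (S * pb - pg) by rewrite mulr_ge0 ?subr_ge0.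
have h2 : 0 <= eps * m * (pb - pg) by rewrite !mulr_ge0 ?subr_ge0.
lra.
Qed.

Lemma convex_lower (pb pg m mg kb kg I eps : R) : 0 < pb -> 0 <= eps -> 0 <= m ->
  kb * pg = kg * pb -> kb <= m -> (pg - eps * pb) * m <= mg * pb ->
  I * pb <= pg -> kg + I * m <= mg + I * kb + eps * m.
Proof.
move=> pb0 eps0 m0 kE km mgE pgI.
rewrite -(ler_pM2r pb0) !mulrDl -kE.
have h1 : 0 <= (m - kb) * (pg - I * pb) by rewrite mulr_ge0 ?subr_ge0.
lra.
Qed.

(* The part c P(a) P(. `&` b1) of the law of T^(n + n0) on a is common to all a,
   so that it does not contribute to the spread dl. *)
Lemma quasi_independent_contract n0 (c : R) b1 p dl q :
  0 < c -> alpha b1 ->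
  (forall n a F, (0 < n)%N -> cyl n a -> measurable F ->
    c * P a * P (F `&` b1) <= P (a `&` iter (n + n0) T @^-1` F)) ->
  (0 < q)%N -> quasi_independent p dl ->
  quasi_independent (n0 + q + p) ((1 - c * P b1) * dl + 2 * (M * r ^+ q)).
Proof.
move=> c0 hb1 hc q0 qi F mF; have [I hI] := qi _ mF.
set eps := M * r ^+ q; set G := iter p T @^-1` F.
have eps0 : 0 <= eps by rewrite mulr_ge0 ?exprn_ge0 ?ltW.
have mG : measurable G by exact: mpre.
have mb1 := mpart hb1.
have mqG : measurable (iter q T @^-1` G) by exact: mpre.
(* The common part is counted exactly, the remaining mass 1 - c P(b1) with the old lower endpoint;
   [eps] pays for distortion, once at each end of the interval. *)
exists (c * P (b1 `&` iter q T @^-1` G) + I * (1 - c * P b1) - eps) => n a np ha.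
have ma := mcyl ha; set e := (n + n0)%N.
have -> : iter (n + (n0 + q + p)) T @^-1` F = iter e T @^-1` (iter q T @^-1` G).
  by rewrite -!preimage_iterD !addnA.
have pe := partition_preimage (measure_preserving_iter e mpT)
  (partition_joined palpha mpT q).
have mX1 : measurable (a `&` iter e T @^-1` (iter q T @^-1` G)).
  by apply: measurableI => //; exact: mpre.
have mX2 : measurable (iter e T @^-1` b1) by exact: mpre.
have mbG : measurable (b1 `&` iter q T @^-1` G) by exact: measurableI.
have mX3 : measurable (iter e T @^-1` (b1 `&` iter q T @^-1` G)) by exact: mpre.
have n1 := null_additive_prob mu mX1; have n2 := null_additive_prob mu mX2.
have n3 := null_additive_prob mu mX3; have n4 := null_additive_prob mu ma.
(* Both inequalities are proved on each q-cylinder [b] visited at time [e] and summed over [b]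
   afterwards. *)
have step b : cyl q b ->
    P (a `&` iter e T @^-1` (iter q T @^-1` G) `&` iter e T @^-1` b) +
    (I + dl) * (c * P a * P (b `&` b1)) <=
    c * P a * P (b `&` iter q T @^-1` G `&` b1) +
    (I + dl + eps) * P (a `&` iter e T @^-1` b) /\
    c * P a * P (b `&` iter q T @^-1` G `&` b1) +
    I * P (a `&` iter e T @^-1` b) <=
    P (a `&` iter e T @^-1` (iter q T @^-1` G) `&` iter e T @^-1` b) +
    I * (c * P a * P (b `&` b1)) + eps * P (a `&` iter e T @^-1` b).
  move=> hb; have mb := mcyl hb.
  have mE : measurable (b `&` iter q T @^-1` G) by exact: measurableI.
  have -> : a `&` iter e T @^-1` (iter q T @^-1` G) `&` iter e T @^-1` b =
      a `&` iter e T @^-1` (b `&` iter q T @^-1` G).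
    by rewrite -setIA; congr (_ `&` _); rewrite -preimage_setI setIC.
  have maI X : measurable X -> measurable (a `&` iter e T @^-1` X).
    by move=> mX; apply: measurableI => //; exact: mpre.
  have [b0|/eqP b0] := eqVneq (P b) 0.
    have z X : measurable X -> X `<=` b -> P X = 0.
      by move=> mX Xb; exact: (prob_subnull mX mb Xb b0).
    have z' X : measurable X -> X `<=` b -> P (a `&` iter e T @^-1` X) = 0.
      move=> mX Xb; apply: (prob_subnull (maI _ mX) (mpre e mX)).
        exact: subIsetr.
      by rewrite prob_iter// z.
    rewrite (z' (b `&` _))// (z (b `&` b1))//; last exact: measurableI.
    rewrite (z (b `&` _ `&` _))//; last 2 first.
    - exact: measurableI.
    - by rewrite -setIA; exact: subIsetl.
    by rewrite (z' b)// !mulr0 !addr0.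
  have pb0 : 0 < P b by rewrite lt_neqAle prob_ge0 andbT eq_sym; exact/eqP.
  have [up lo] := forget_past n0 np ha q0 hb mE (@subIsetl _ _ _).
  have /andP[lowI upI] := hI _ _ q0 hb; rewrite preimage_iterD -/G in lowI upI.
  (* [b] is contained in [b1] or meets it in a null set, so the common part has on [b] the same
     conditional law as [mu]. *)
  have kE : c * P a * P (b `&` b1) * P (b `&` iter q T @^-1` G) =
      c * P a * P (b `&` iter q T @^-1` G `&` b1) * P b.
    rewrite -!mulrA; congr (_ * (_ * _)).
    have [c1 hc1 bc1] := joined_sub_part q0 hb.
    have [c1b1|c1b1] := pselect (c1 = b1).
      rewrite c1b1 in bc1; rewrite (setIidl bc1) setIAC (setIidl bc1).
      by rewrite mulrC.
    have bb1 : P (b `&` b1) = 0.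
      apply: (prob_subnull _ _ _ (disjoint_parts hc1 hb1 c1b1)).
      - exact: measurableI.
      - by apply: measurableI => //; exact: mpart.
      - exact: setSI.
    rewrite bb1 mul0r setIAC (prob_subnull _ _ _ bb1) ?mul0r//.
    - by apply: measurableI => //; exact: measurableI.
    - exact: measurableI.
  have kb := hc _ _ _ np ha mb; rewrite -/e in kb.
  split.
  - apply: (convex_upper pb0 eps0 (prob_ge0 _ _) kE kb up upI).
    by apply: le_prob.
  - exact: (convex_lower pb0 eps0 (prob_ge0 _ _) kE kb lo lowI).
have e2 b : measurable b -> P (iter e T @^-1` b1 `&` iter e T @^-1` b) = P (b `&` b1).
  by move=> mb; rewrite -preimage_setI setIC prob_iter//; exact: measurableI.
have e3 b : measurable b ->
    P (iter e T @^-1` (b1 `&` iter q T @^-1` G) `&` iter e T @^-1` b) =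
    P (b `&` iter q T @^-1` G `&` b1).
  move=> mb; rewrite -preimage_setI prob_iter//; last exact: measurableI.
  by rewrite setIC setIA setIAC.
have P2 : P (iter e T @^-1` b1) = P b1 by rewrite prob_iter.
have P3 : P (iter e T @^-1` (b1 `&` iter q T @^-1` G)) = P (b1 `&` iter q T @^-1` G).
  by rewrite prob_iter.
apply/andP; split.
- have n5 := null_additiveD (null_additiveD
    (null_additiveZ (c * P a) n3) (null_additiveZ (I - eps) n4))
    (null_additiveZ (-1) (null_additiveD n1 (null_additiveZ (I * (c * P a)) n2))).
  have := partition_le0 pe n5; rewrite !setIT P2 P3 => h.
  lapply h; first by lra.
  move=> _ [b hb <-]; rewrite e2 ?e3; [|exact: mcyl hb..].
  by have [_] := step _ hb; lra.
- have n5 := null_additiveD (null_additiveD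
    n1 (null_additiveZ ((I + dl) * (c * P a)) n2))
    (null_additiveZ (-1) (null_additiveD (null_additiveZ (c * P a) n3)
      (null_additiveZ (I + dl + eps) n4))).
  have := partition_le0 pe n5; rewrite !setIT P2 P3 => h.
  lapply h; first by lra.
  move=> _ [b hb <-]; rewrite e2 ?e3; [|exact: mcyl hb..].
  by have [+ _] := step _ hb; lra.
Qed.

End GibbsMarkovMixing.

(** * Uniform decorrelation after a long gap *)

Lemma exists_expr_lt (R : realType) (x e : R) : 0 <= x -> x < 1 -> 0 < e ->
  exists n, x ^+ n.+1 < e.
Proof.
move=> x0 x1 e0.
have /cvgrPdist_lt /(_ _ e0) [N _ /(_ N (leqnn N))] : x ^+ n @[n --> \oo] --> 0.
  by apply: cvg_expr; rewrite ger0_norm.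
rewrite sub0r normrN ger0_norm ?exprn_ge0// => xN; exists N.
by apply: le_lt_trans xN; rewrite ler_wiXn2l// ltW.
Qed.

Section Decay.
Context (R : realType) (d : measure_display) (Omega : measurableType d).
Context (mu : probability Omega R) (T : Omega -> Omega).
Context (alpha : set (set Omega)).
Context (palpha : countable_partition_mod mu alpha).
Context (mpT : measure_preserving mu T).
Implicit Types (a b A F : set Omega).
Local Notation P := (prob mu).
Local Notation cyl := (joined T alpha).

Lemma quasi_independent_le p (dl dl' : R) : dl <= dl' ->
  quasi_independent mu T alpha p dl -> quasi_independent mu T alpha p dl'.
Proof.
move=> le_dl qi F mF; have [I hI] := qi _ mF; exists I => n a n0 ha.
have /andP[-> /le_trans] := hI _ _ n0 ha; apply.
by rewrite ler_wpM2r ?prob_ge0// lerD2l.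
Qed.

(** Iterate the contraction from the trivial spread 1, with q fixed so large that the added
    distortion error never accumulates beyond e / 2. *)
Lemma quasi_independent_small (e : R) : gibbs_markov mu T alpha ->
  topologically_mixing mu T alpha -> 0 < e ->
  exists p, quasi_independent mu T alpha p e.
Proof.
move=> hGM mixing e0; have markov := gm_markov hGM.
have [r [M [r0 r1 M0 dist]]] := gm_distortion hGM.
have [n0 [c [b1 [c0 hb1 b10 hc]]]] :=
  doeblin palpha mpT markov r0 r1 M0 dist mixing (gm_big_image hGM).
have mb1 := measurable_part palpha hb1.
have b1p : 0 < P b1 by rewrite lt_neqAle prob_ge0 andbT eq_sym; exact/eqP.
set kap := c * P b1.
have kap0 : 0 < kap by rewrite mulr_gt0.
(* The minorization for the cylinder [b1] and the full space, divided by P(b1). *)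
have kap1 : kap <= 1.
  have cb1 : cyl 1 b1 by rewrite joined1.
  have := hc _ _ _ (ltn0Sn 0) cb1 measurableT.
  rewrite preimage_setT setTI setIT -/kap.
  by rewrite -{2}[P b1]mul1r ler_pM2r.
(* With this choice the additive error is at most kap e / 2, exactly what the factor 1 - kap removes
   from e / 2. *)
have [q rq] : exists q, r ^+ q.+1 < kap * e / (4 * M).
  by apply: exists_expr_lt; [exact: ltW|exact: r1|rewrite divr_gt0 ?mulr_gt0].
have Mrq : 2 * (M * r ^+ q.+1) <= kap * (e / 2).
  by move: rq; rewrite ltr_pdivlMr ?mulr_gt0//; lra.
have iter_qi j : exists p, quasi_independent mu T alpha p ((1 - kap) ^+ j + e / 2).
  elim: j => [|j [p qi]].
    exists 0%N; apply: quasi_independent_le (quasi_independent0 palpha mpT).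
    by rewrite expr0 lerDl divr_ge0// ltW.
  exists (n0 + q.+1 + p)%N.
  have := quasi_independent_contract palpha mpT markov r0 r1 M0 dist c0 hb1 hc
    (ltn0Sn q) qi.
  apply: quasi_independent_le; rewrite -/kap mulrDr -exprS -addrA lerD2l.
  by move: Mrq; lra.
have [j hj] : exists j, (1 - kap) ^+ j.+1 < e / 2.
  by apply: exists_expr_lt; [rewrite subr_ge0|rewrite gtrBl|rewrite divr_gt0].
have [p qi] := iter_qi j.+1; exists p; apply: quasi_independent_le qi.
by move: hj; lra.
Qed.

(** By invariance P(F) is an average of the conditional probabilities, hence lies between I and I +
    dl. Each is therefore within [dl] of P(F), and A is a union of m-cylinders mod [mu]. *)
Lemma quasi_independent_decay p (dl : R) m A F :
  quasi_independent mu T alpha p dl -> (0 < m)%N -> <<s cyl m >> A ->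
  measurable F ->
  `|P (A `&` iter (m + p) T @^-1` F) - P A * P F| <= dl * P A.
Proof.
move=> qi m0 hA mF; have [I hI] := qi _ mF.
have pcyl n := partition_joined palpha mpT n.
have mX n : measurable (iter n T @^-1` F) := measurable_iter mpT n mF.
have nT := null_additive_prob mu measurableT.
have n1 := null_additive_prob mu (mX (1 + p)%N).
have PX n : P (iter n T @^-1` F) = P F by exact: prob_iter.
have IF : I <= P F.
  have := partition_le0 (pcyl 1%N) (null_additiveD (null_additiveZ I nT)
    (null_additiveZ (-1) n1)).
  rewrite !setIT probT PX => h; lapply h; first by lra.
  move=> a ha; have /andP[+ _] := hI _ _ (ltn0Sn 0) ha.
  by rewrite setTI setIC; lra.
have FI : P F <= I + dl.
  have := partition_le0 (pcyl 1%N) (null_additiveD n1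
    (null_additiveZ (- (I + dl)) nT)).
  rewrite !setIT probT PX => h; lapply h; first by lra.
  move=> a ha; have /andP[_] := hI _ _ (ltn0Sn 0) ha.
  by rewrite setTI [X in P X]setIC; lra.
have [mA dA] := generated_dichotomic (pcyl m) hA.
set X := iter (m + p) T @^-1` F.
have mAX : measurable (A `&` X) by apply: measurableI => //; exact: mX.
have key b : cyl m b -> (P F - dl) * P (A `&` b) <= P (A `&` X `&` b) /\
    P (A `&` X `&` b) <= (P F + dl) * P (A `&` b).
  move=> hb; have mb := measurable_joined palpha mpT hb.
  have mAb : measurable (A `&` b) by exact: measurableI.
  have mAXb : measurable (A `&` X `&` b) by exact: measurableI.
  have [Ab0|bA0] := dA _ hb.
    rewrite setIC in Ab0; rewrite Ab0 !mulr0.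
    suff -> : P (A `&` X `&` b) = 0 by [].
    by apply: prob_subnull Ab0 => // x [[Ax _] bx].
  have -> : P (A `&` b) = P b by rewrite setIC (prob_setI_full mb mA bA0).
  have -> : P (A `&` X `&` b) = P (b `&` X).
    have mbX : measurable (b `&` X) by apply: measurableI => //; exact: mX.
    rewrite setIC [A `&` X]setIC setIA (prob_setI_full mbX mA)//.
    apply: prob_subnull bA0; [exact: measurableD|exact: measurableD|].
    by move=> x [[]].
  have /andP[lo up] := hI _ _ m0 hb; rewrite -/X in lo up.
  have Pb := prob_ge0 mu b.
  split.
  - by apply: le_trans lo; rewrite ler_wpM2r// lerBlDr.
  - by apply: le_trans up _; rewrite ler_wpM2r// lerD2r.
have n2 := null_additive_prob mu mAX; have n3 := null_additive_prob mu mA.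
rewrite ler_norml; apply/andP; split.
- have := partition_le0 (pcyl m) (null_additiveD (null_additiveZ (P F - dl) n3)
    (null_additiveZ (-1) n2)).
  rewrite !setIT => h; lapply h; first by lra.
  by move=> b /key[+ _]; lra.
- have := partition_le0 (pcyl m) (null_additiveD n2
    (null_additiveZ (- (P F + dl)) n3)).
  rewrite !setIT => h; lapply h; first by lra.
  by move=> b /key[_ +]; lra.
Qed.

End Decay.

(** * Visit counts and their comparison with the binomial law *)

Section Counting.
Context (R : realType) (d : measure_display) (Omega : measurableType d).
Context (mu : probability Omega R) (T : Omega -> Omega).
Context (mpT : measure_preserving mu T).
Context (A : set Omega) (mA : measurable A).
Implicit Types (L k e j : nat) (Y : set Omega).
Local Notation P := (prob mu).

Definition hits L x : nat := (\sum_(i < L) (iter i T x \in A))%N.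

Definition hit_set L k : set Omega := [set x | hits L x = k].

Lemma sum_indic_hits L x :
  \sum_(i < L) \1_A (iter i T x) = (hits L x)%:R :> R.
Proof. by rewrite /hits natr_sum; apply: eq_bigr => i _; rewrite indicE. Qed.

Lemma hits0 x : hits 0 x = 0%N.
Proof. by rewrite /hits big_ord0. Qed.

Lemma hitsS L x : hits L.+1 x = ((x \in A) + hits L (T x))%N.
Proof.
by rewrite /hits big_ord_recl; congr addn; apply: eq_bigr => i _; rewrite -iterSr.
Qed.

(** The predecessor also covers L = 0, as the truncated [L - j] in [hit_set_shift] requires. *)
Lemma hits_notin L x : ~ A x -> hits L x = hits L.-1 (T x).
Proof.
move=> Ax; case: L => [|L]; first by rewrite !hits0.
by rewrite hitsS memNset.
Qed.

Lemma hit_setS0 L : hit_set L.+1 0 = T @^-1` hit_set L 0 `\` A.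
Proof.
apply/seteqP; split => x; rewrite /hit_set /= hitsS.
  by case: (boolP (x \in A)) => // /negP xA; rewrite add0n => h; split=> // /mem_set.
by move=> [h Ax]; rewrite memNset.
Qed.

Lemma hit_setSS L k : hit_set L.+1 k.+1 =
  (A `&` T @^-1` hit_set L k) `|` (T @^-1` hit_set L k.+1 `\` A).
Proof.
apply/seteqP; split => x; rewrite /hit_set /= hitsS.
  case: (boolP (x \in A)) => [/set_mem Ax [h]|/negP xA]; first by left.
  by rewrite add0n => h; right; split=> // /mem_set.
by move=> [[Ax h]|[h Ax]]; [rewrite mem_set// h|rewrite memNset].
Qed.

Lemma measurable_hit_set L k : measurable (hit_set L k).
Proof.
elim: L k => [|L ih] k.
  rewrite (_ : hit_set 0 k = if k == 0%N then setT else set0); first by case: ifP.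
  apply/seteqP; split => x; rewrite /hit_set /= hits0; first by move=> <-.
  by case: eqP.
have mT j : measurable (T @^-1` hit_set L j) by apply: (measurable_preimage mpT).
case: k => [|k]; first by rewrite hit_setS0; exact: measurableD.
by rewrite hit_setSS; apply: measurableU; [exact: measurableI|exact: measurableD].
Qed.

Let mH := measurable_hit_set.
Let mHT n L k : measurable (iter n T @^-1` hit_set L k) :=
  measurable_iter mpT n (mH L k).

Lemma prob_hit_setS L k : P (hit_set L.+1 k) =
  P (hit_set L k) - P (A `&` iter 1 T @^-1` hit_set L k) +
  (if k is k'.+1 then P (A `&` iter 1 T @^-1` hit_set L k') else 0).
Proof.
have eD : P (T @^-1` hit_set L k `\` A) =
    P (hit_set L k) - P (A `&` T @^-1` hit_set L k).
  rewrite -(prob_preimage mpT (mH L k)).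
  rewrite [X in _ = X - _](prob_splitI mu (mHT 1 L k) mA).
  by rewrite [X in P X + _]setIC [LHS](_ : _ = P (iter 1 T @^-1` hit_set L k `\` A))//; lra.
case: k eD => [|k] eD; first by rewrite hit_setS0 eD addr0.
rewrite hit_setSS probU ?eD; first by rewrite addrC.
- by apply: measurableI => //; exact: (mHT 1).
- by apply: measurableD => //; exact: (mHT 1).
- by apply/seteqP; split=> // x [[Ax _] [_ /(_ Ax)]].
Qed.

Lemma prob_dist_le Y W X1 X2 : measurable Y -> measurable W ->
  measurable X1 -> measurable X2 -> X1 `<=` Y -> X2 `<=` Y ->
  X1 `\` W = X2 `\` W -> `|P X1 - P X2| <= P (Y `&` W).
Proof.
move=> mY mW mX1 mX2 X1Y X2Y X12.
rewrite (prob_splitI mu mX1 mW) (prob_splitI mu mX2 mW) X12.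
rewrite [X in `|X|](_ : _ = P (X1 `&` W) - P (X2 `&` W)); last by ring.
rewrite ler_norml.
have le X : measurable X -> X `<=` Y -> P (X `&` W) <= P (Y `&` W).
  by move=> mX XY; apply: le_prob; [exact: measurableI|exact: measurableI|exact: setSI].
have := le _ mX1 X1Y; have := le _ mX2 X2Y.
have := prob_ge0 mu (X1 `&` W); have := prob_ge0 mu (X2 `&` W).
by move=> ? ? ? ?; apply/andP; split; lra.
Qed.

(** Skipping the first j times alters the count only if one of them is a visit; they are dropped one
    at a time, each at the cost of the probability of that visit. *)
Lemma hit_set_shift Y e j L k : measurable Y ->
  `|P (Y `&` iter e T @^-1` hit_set L k) -
    P (Y `&` iter (e + j) T @^-1` hit_set (L - j) k)| <=
  \sum_(i < j) P (Y `&` iter (e + i) T @^-1` A).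
Proof.
move=> mY; elim: j => [|j ih].
  by rewrite big_ord0 addn0 subn0 subrr normr0.
rewrite big_ord_recr/=.
apply: le_trans (ler_distD (P (Y `&` iter (e + j) T @^-1` hit_set (L - j) k)) _ _) _.
apply: lerD ih _; apply: prob_dist_le => //;
  do ?exact: (measurable_iter mpT); do ?exact: (measurableI _ _ mY (mHT _ _ _)).
rewrite addnS; apply/seteqP; split => x [[Yx h] nA]; split=> //; split=> //.
    by move: h; rewrite /hit_set /= (hits_notin _ nA) -subnS.
  by move: h; rewrite /hit_set /= (hits_notin _ nA) -subnS.
Qed.

(** Three replacements: skip the times 1 to j after a visit, decorrelate across the gap j + 1, and
    restore the skipped times without conditioning on A. Each accounts for one term of the bound. *)
Lemma hit_set_decorrelate j (dl : R) L k :
  (forall F, measurable F ->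
    `|P (A `&` iter j.+1 T @^-1` F) - P A * P F| <= dl * P A) ->
  `|P (A `&` iter 1 T @^-1` hit_set L k) - P A * P (hit_set L k)| <=
  \sum_(i < j) P (A `&` iter i.+1 T @^-1` A) + dl * P A + j%:R * P A ^+ 2.
Proof.
move=> hdl; have h1 := hit_set_shift 1 j L k mA.
have h2 := hdl _ (mH (L - j) k).
have h3 := hit_set_shift 0 j L k measurableT.
rewrite !setTI !prob_iter// in h3.
have h4 : `|P (hit_set L k) - P (hit_set (L - j) k)| <= j%:R * P A.
  apply: le_trans h3 _.
  rewrite (eq_bigr (fun=> P A)) => [|i _]; last by rewrite setTI (prob_iter mpT).
  by rewrite sumr_const card_ord mulr_natl.
have A0 := prob_ge0 mu A.
have h5 : `|P A * P (hit_set (L - j) k) - P A * P (hit_set L k)| <= j%:R * P A ^+ 2.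
  rewrite -mulrBr normrM ger0_norm// distrC expr2 mulrA [leRHS]mulrC.
  by rewrite ler_wpM2l.
rewrite add1n in h1.
apply: le_trans (ler_distD (P (A `&` iter j.+1 T @^-1` hit_set (L - j) k)) _ _) _.
rewrite -addrA; apply: lerD; first exact: h1.
apply: le_trans (ler_distD (P A * P (hit_set (L - j) k)) _ _) _.
exact: lerD.
Qed.

(** Each step of the recursion replaces at most two correlations by products, whence 2 eta; the
    weights 1 - P(A) and P(A) do not amplify earlier errors. *)
Lemma hit_set_binomial (eta : R) :
  (forall L k, `|P (A `&` iter 1 T @^-1` hit_set L k) - P A * P (hit_set L k)| <= eta) ->
  forall L k, `|P (hit_set L k) -
    'C(L, k)%:R * P A ^+ k * (1 - P A) ^+ (L - k)| <= L%:R * (2 * eta).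
Proof.
move=> heta; have eta0 : 0 <= eta := le_trans (normr_ge0 _) (heta 0%N 0%N).
have A0 := prob_ge0 mu A; have A1 := prob_le1 mu mA.
set x := P A in heta A0 A1 *.
pose b L k : R := 'C(L, k)%:R * x ^+ k * (1 - x) ^+ (L - k).
have bS L k : b L.+1 k = (1 - x) * b L k + x * (if k is k'.+1 then b L k' else 0).
  case: k => [|k]; first by rewrite /b !bin0 !subn0 mulr0 addr0 exprS; lra.
  rewrite /b binS subSS natrD exprS.
  (* For L <= k the subtraction [L - k.+1] is truncated, but its binomial coefficient is 0. *)
  have [kL|kL] := ltnP k L; last by rewrite bin_small//; lra.
  by rewrite -(subnSK kL) [(1 - x) ^+ (_ - _).+1]exprS; lra.
elim=> [|L ih] k.
  rewrite mul0r /hit_set (_ : [set x | _] = if k == 0%N then setT else set0).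
    case: k => [|k]; first by rewrite bin0 !expr0 probT !mulr1 subrr normr0.
    by rewrite bin0n prob_set0 !mul0r subrr normr0.
  apply/seteqP; split => y; rewrite /= hits0; first by move=> <-.
  by case: eqP.
have main : `|P (hit_set L.+1 k) - ((1 - x) * P (hit_set L k) +
    x * (if k is k'.+1 then P (hit_set L k') else 0))| <= 2 * eta.
  rewrite prob_hit_setS; have := heta L k; case: k => [|k].
    by rewrite mulr0 !ler_norml => /andP[? ?]; apply/andP; split; lra.
  have := heta L k; rewrite !ler_norml => /andP[? ?] /andP[? ?].
  by apply/andP; split; lra.
rewrite -/(b _ _) bS.
have L0 : 0 <= L%:R * (2 * eta) by rewrite !mulr_ge0.
have ihk : `|(1 - x) * P (hit_set L k) - (1 - x) * b L k| <= (1 - x) * (L%:R * (2 * eta)).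
  by rewrite -mulrBr normrM ger0_norm ?subr_ge0// ler_wpM2l ?subr_ge0//; exact: ih.
have ihk' : `|x * (if k is k'.+1 then P (hit_set L k') else 0) -
    x * (if k is k'.+1 then b L k' else 0)| <= x * (L%:R * (2 * eta)).
  rewrite -mulrBr normrM ger0_norm// ler_wpM2l//.
  by case: k {main ihk} => [|k]; [rewrite subrr normr0|exact: ih].
rewrite -natr1 mulrDl mul1r.
move: main ihk ihk'; rewrite !ler_norml => /andP[? ?] /andP[? ?] /andP[? ?].
by apply/andP; split; lra.
Qed.

End Counting.

(** * Poisson limit of the binomial weights *)

Lemma cvg_pow_poisson (R : realType) (u : nat -> R) (t : R) :
  (forall n, (0 < n)%N -> 0 <= u n) -> n%:R * u n @[n --> \oo] --> t ->
  u n @[n --> \oo] --> 0 -> (1 - u n) ^+ n @[n --> \oo] --> expR (- t).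
Proof.
move=> u0 nu ucv.
have u1 : \forall n \near \oo, u n < 1 by apply: (cvgr_lt 0).
(* Both bounds come from 1 + y <= exp(y): at y = -u for the upper one, and at y = u / (1 - u), where
   1 + y = 1 / (1 - u), for the lower one. *)
apply: (@squeeze_cvgr _ _ _ _ (fun n => expR (- (n%:R * u n / (1 - u n))))
  (fun n => expR (- (n%:R * u n)))).
- near=> n.
  have n0 : (0 < n)%N by near: n; exact: nbhs_infty_gt.
  have un0 := u0 _ n0.
  have un1 : u n < 1 by near: n.
  have s0 : 0 < 1 - u n by rewrite subr_gt0.
  apply/andP; split.
    rewrite -mulrA -mulrN expRM_natl lerXn2r ?nnegrE ?expR_ge0 ?(ltW s0)//.
    rewrite expRN -[leRHS]invrK lef_pV2 ?posrE ?expR_gt0 ?invr_gt0//.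
    apply: le_trans (expR_ge1Dx _).
    rewrite [leLHS](_ : _ = 1 + u n / (1 - u n)) ?lexx//.
    by field; exact: lt0r_neq0.
  rewrite -mulrN expRM_natl lerXn2r ?nnegrE ?expR_ge0 ?(ltW s0)//.
  exact: expR_ge1Dx.
- apply: continuous_cvg; first exact: continuous_expR.
  apply: cvgN; rewrite -[X in _ --> X]mulr1; apply: cvgM => //.
  rewrite -[X in _ --> X]invr1; apply: cvgV; first exact: oner_neq0.
  by rewrite -[X in _ --> X]subr0; apply: cvgB => //; exact: cvg_cst.
- apply: continuous_cvg; first exact: continuous_expR.
  exact: cvgN.
Unshelve. all: by end_near. Qed.

Lemma cvg_mulr_nat0 (R : realType) (u : nat -> R) (t : R) :
  n%:R * u n @[n --> \oo] --> t -> u n @[n --> \oo] --> 0.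
Proof.
move=> nu; have inv0 : (n%:R : R)^-1 @[n --> \oo] --> 0.
  by rewrite -cvg_shiftS; exact: cvg_harmonic.
rewrite -[X in _ --> X](mul0r t).
apply: cvg_trans (cvgM inv0 nu); apply: near_eq_cvg; near=> n.
rewrite /= mulKf// pnatr_eq0 -lt0n; near: n; exact: nbhs_infty_gt.
Unshelve. all: by end_near. Qed.

Lemma cvg_exprn (R : realType) (f : nat -> R) (l : R) k :
  f n @[n --> \oo] --> l -> (f n ^+ k : R) @[n --> \oo] --> l ^+ k.
Proof.
by move=> fl; apply: (@continuous_cvg _ _ _ _ _ f (fun x : R => x ^+ k) _ _ fl);
  exact: exprn_continuous.
Qed.

(** Write the coefficient as a falling factorial over k!. Its k factors (n - i), each multiplied by
    u, tend to t, and the k missing powers of 1 - u tend to 1. *)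
Lemma cvg_binomial_poisson (R : realType) (u : nat -> R) (t : R) k :
  (forall n, (0 < n)%N -> 0 <= u n) -> n%:R * u n @[n --> \oo] --> t ->
  'C(n, k)%:R * u n ^+ k * (1 - u n) ^+ (n - k) @[n --> \oo] -->
    t ^+ k / k`!%:R * expR (- t).
Proof.
move=> u0 nu; have ucv := cvg_mulr_nat0 nu.
have ff : (n ^_ k)%:R * u n ^+ k @[n --> \oo] --> t ^+ k.
  elim: k => [|k ih].
    by under eq_fun do rewrite ffactn0 expr0 mulr1; exact: cvg_cst.
  rewrite exprSr.
  have h : n%:R * u n - k%:R * u n @[n --> \oo] --> t.
    rewrite -[X in _ --> X]subr0 -[X in _ - X](mulr0 k%:R).
    by apply: cvgB => //; apply: cvgM => //; exact: cvg_cst.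
  apply: cvg_trans (cvgM ih h); apply: near_eq_cvg; near=> n.
  rewrite /= ffactnSr natrM natrB; first by rewrite exprSr; lra.
  near: n; exact: nbhs_infty_ge.
have pw : (1 - u n) ^+ (n - k) @[n --> \oo] --> expR (- t).
  have h1 : (1 - u n) ^+ k @[n --> \oo] --> (1 : R).
    rewrite -[X in _ --> X](expr1n R k); apply: cvg_exprn.
    have h : (1 - u n : R) @[n --> \oo] --> (1 - 0 : R).
      by apply: cvgB => //; exact: cvg_cst.
    by rewrite subr0 in h.
  rewrite -[X in _ --> X]mulr1 -[X in _ * X]invr1.
  apply: cvg_trans (cvgM (cvg_pow_poisson u0 nu ucv) (cvgV (oner_neq0 _) h1)).
  apply: near_eq_cvg; near=> n => /=.
  have un1 : u n < 1 by near: n; apply: (cvgr_lt 0).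
  have kn : (k <= n)%N by near: n; exact: nbhs_infty_ge.
  have -> : (1 - u n) ^+ n = (1 - u n) ^+ (n - k) * (1 - u n) ^+ k.
    by rewrite -exprD subnK.
  rewrite mulfK// expf_neq0//.
  by rewrite lt0r_neq0// subr_gt0.
have h : ((n ^_ k)%:R * u n ^+ k / k`!%:R * (1 - u n) ^+ (n - k) : R)
    @[n --> \oo] --> t ^+ k / k`!%:R * expR (- t).
  by apply: cvgM pw; apply: cvgM ff _; exact: cvg_cst.
apply: cvg_trans h; apply: near_eq_cvg; near=> n => /=.
congr (_ * _); rewrite -bin_ffact natrM.
by rewrite mulrAC mulfK// pnatr_eq0 -lt0n fact_gt0.
Unshelve. all: by end_near. Qed.

(** * The Poisson law for visit counts *)

Theorem theorem4p1 (R : realType) (d : measure_display)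
    (Omega : measurableType d) (mu : probability Omega R)
    (T : Omega -> Omega) (alpha : set (set Omega))
    (hGM : gibbs_markov mu T alpha)
    (hpres : measure_preserving mu T)
    (hmix : topologically_mixing mu T alpha)
    (A : nat -> set Omega)
    (hA : forall n, (0 < n)%N -> measurable (A n))
    (ha : exists2 m : nat, (0 < m)%N &
       forall n, (0 < n)%N -> <<s joined T alpha m >> (A n))
    (hb : forall i : nat, (0 < i)%N ->
       fine (mu (A n `&` (iter i T @^-1` A n))) / fine (mu (A n))
         @[n --> \oo] --> (0 : R))
    (t : R) (ht : 0 < t)
    (hlim : n%:R * fine (mu (A n)) @[n --> \oo] --> t) :
  forall k : nat,
    fine (mu [set x | \sum_(i < n) \1_(A n) (iter i T x) = k%:R :> R])
      @[n --> \oo] --> t ^+ k / k`!%:R * expR (- t).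
Proof.
move=> k; have palpha := gm_partition hGM; have [m m0 hm] := ha.
pose P := prob mu; pose u n := P (A n).
pose b n : R := 'C(n, k)%:R * u n ^+ k * (1 - u n) ^+ (n - k).
have u0 n : 0 <= u n by exact: prob_ge0.
have bcv : b n @[n --> \oo] --> t ^+ k / k`!%:R * expR (- t).
  exact: cvg_binomial_poisson.
pose p n := P (hit_set T (A n) n k).
have pE n : fine (mu [set x | \sum_(i < n) \1_(A n) (iter i T x) = k%:R :> R]) = p n.
  rewrite /p /P /prob; congr (fine (mu _)); apply/seteqP; split => x /=.
    by rewrite sum_indic_hits => /eqP; rewrite eqr_nat => /eqP.
  by rewrite sum_indic_hits => ->.
under eq_fun do rewrite pE.
suff dcv : p n - b n @[n --> \oo] --> (0 : R).
  have h : (p n - b n + b n : R) @[n --> \oo] --> 0 + t ^+ k / k`!%:R * expR (- t).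
    exact: cvgD.
  rewrite add0r in h; apply: cvg_trans h; apply: near_eq_cvg; near=> n.
  by rewrite subrK.
apply/cvgrPdist_lt => e e0.
(* The error bound will tend to 2 t dl, that is e / 2. *)
pose dl := e / (4 * t).
have dl0 : 0 < dl by rewrite divr_gt0// mulr_gt0.
have [q qi] := quasi_independent_small palpha hpres hGM hmix dl0.
(* The gap j + 1 of [hit_set_decorrelate] is the cylinder length m plus the decorrelation time q. *)
pose j := (m + q).-1.
have jE : j.+1 = (m + q)%N by rewrite prednK// addn_gt0 m0.
pose eta n := \sum_(i < j) P (A n `&` iter i.+1 T @^-1` A n) + dl * u n + j%:R * u n ^+ 2.
have bound n : (0 < n)%N -> `|p n - b n| <= n%:R * (2 * eta n).
  move=> n0; apply: hit_set_binomial => // [|L l]; first exact: hA.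
  apply: hit_set_decorrelate => // [|F mF]; first exact: hA.
  rewrite jE.
  exact: (quasi_independent_decay palpha hpres qi m0 (hm _ n0) mF).
have ucv : u n @[n --> \oo] --> 0 by exact: cvg_mulr_nat0 hlim.
have sumcv : (\sum_(i < j) P (A n `&` iter i.+1 T @^-1` A n) / u n : R) @[n --> \oo] --> 0.
  elim: (j) => [|J ih]; first by under eq_fun do rewrite big_ord0; exact: cvg_cst.
  have h : (\sum_(i < J) P (A n `&` iter i.+1 T @^-1` A n) / u n +
      P (A n `&` iter J.+1 T @^-1` A n) / u n : R) @[n --> \oo] --> (0 + 0 : R).
    by apply: cvgD ih _; exact: hb.
  rewrite addr0 in h; apply: cvg_trans h; apply: near_eq_cvg; near=> n.
  by rewrite big_ord_recr.
have lim : (2 * (n%:R * u n) *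
    (\sum_(i < j) P (A n `&` iter i.+1 T @^-1` A n) / u n + dl + j%:R * u n) : R)
    @[n --> \oo] --> 2 * t * (0 + dl + j%:R * 0).
  apply: cvgM; first by apply: cvgM => //; exact: cvg_cst.
  apply: cvgD; last by apply: cvgM => //; exact: cvg_cst.
  by apply: cvgD => //; exact: cvg_cst.
have lt_e : 2 * t * (0 + dl + j%:R * 0) < e.
  rewrite add0r mulr0 addr0 /dl.
  have -> : 2 * t * (e / (4 * t)) = e / 2 by field; rewrite gt_eqF.
  by rewrite ltr_pdivrMr// mulr_natr mulr2n ltrDl.
have near_lt := cvgr_lt _ lim _ lt_e.
near=> n.
have n0 : (0 < n)%N by near: n; exact: nbhs_infty_gt.
rewrite sub0r normrN (le_lt_trans (bound _ n0))//.
(* Factoring out u n brings in the ratios of condition (b) and the convergent product n u n. *)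
have -> : n%:R * (2 * eta n) = 2 * (n%:R * u n) *
    (\sum_(i < j) P (A n `&` iter i.+1 T @^-1` A n) / u n + dl + j%:R * u n).
  have sE : \sum_(i < j) P (A n `&` iter i.+1 T @^-1` A n) =
      u n * (\sum_(i < j) P (A n `&` iter i.+1 T @^-1` A n) / u n).
    rewrite big_distrr/=; apply: eq_bigr => i _.
    (* If u n = 0 the ratio carries no information, but its numerator vanishes as well. *)
    have [un0|un0] := eqVneq (u n) 0; last by rewrite mulrC divfK.
    rewrite un0 mul0r; have mAn := hA _ n0.
    apply: prob_subnull un0 => //; apply: measurableI => //.
    exact: (measurable_iter hpres).
  by rewrite /eta [in LHS]sE; ring.
near: n; exact: near_lt.
Unshelve. all: by end_near. Qed.
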